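(* \[ \liminf_{n\to\infty}\frac{F(n)-f(n,n)}{n\log n}\ \ge\ \frac{1}{e}. \]
   Context: $\mathbb{N}=\{1,2,3,\ldots\}$ and $\log$ is the natural logarithm. For $n,m\in\mathbb{N}$, $f(n,m)$ denotes the least nonnegative integer $h$ such that the interval $(m,m+h]$ contains pairwise distinct integers $a_1,\ldots,a_n$ with $i\mid a_i$ for all $1\le i\le n$. Such an $h$ always exists (indeed $f(n,m)\le n(n+1)/2$), and for fixed $n$ the function $m\mapsto f(n,m)$ is periodic modulo $\operatorname{lcm}(1,\ldots,n)$, so $F(n):=\max_{m\in\mathbb{N}}f(n,m)$ is finite and attained. Here $e$ is the base of the natural logarithm. *)

(* Defs.v *)
From mathcomp Require Import all_boot all_order all_algebra.
From mathcomp Require Import all_classical all_reals all_analysis.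

Set Implicit Arguments.
Unset Strict Implicit.
Unset Printing Implicit Defensive.

Local Open Scope nat_scope.

(* As m >= 0, integers of (m, m + h] are natural numbers. Only the values
   a 1, ..., a n of the sequence a are constrained. *)
Definition has_multiples (n m h : nat) : Prop :=
  exists a : nat -> nat,
    (forall i j, 1 <= i <= n -> 1 <= j <= n -> a i = a j -> i = j) /\
    (forall i, 1 <= i <= n -> (m < a i <= m + h) && (i %| a i)).

(* Each block (m + (i - 1) * n, m + i * n], 1 <= i <= n, contains a multiple
   of i. *)
Lemma has_multiples_sqr (n m : nat) : has_multiples n m (n * n).
Proof.
pose b i := m + i.-1 * n.
pose a i := (b i %/ i).+1 * i.
have Ha i : 1 <= i <= n -> b i < a i <= b i + n.
  move=> /andP[i0 iin]; rewrite /a ltn_ceil //= mulSn addnC leq_add //.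
  exact: leq_divM.
have lt_a i j : 1 <= i <= n -> 1 <= j <= n -> i < j -> a i < a j.
  move=> Hi Hj ij; case/andP: (Ha i Hi) => _ ai; case/andP: (Ha j Hj) => aj _.
  apply: leq_ltn_trans ai (leq_ltn_trans _ aj).
  rewrite /b -addnA leq_add2l -mulSnr leq_mul2r prednK; last by case/andP: Hi.
  by rewrite -ltnS (ltn_predK ij) ij orbT.
exists a; split=> [i j Hi Hj aij|i Hi].
  case: (ltngtP i j) => // ij.
    by have := lt_a _ _ Hi Hj ij; rewrite aij ltnn.
  by have := lt_a _ _ Hj Hi ij; rewrite aij ltnn.
case/andP: (Ha i Hi) => lo hi; case/andP: Hi => i0 iin.
rewrite dvdn_mull // andbT (leq_ltn_trans _ lo) ?leq_addr //=.
apply: leq_trans hi _; rewrite /b -addnA leq_add2l -mulSnr prednK //.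
by rewrite leq_mul2r iin orbT.
Qed.

Lemma exists_has_multiples (n m : nat) : exists h, `[< has_multiples n m h >].
Proof. by exists (n * n); apply/asboolP/has_multiples_sqr. Qed.

Definition f (n m : nat) : nat := ex_minn (exists_has_multiples n m).

Lemma has_multiples_f (n m : nat) : has_multiples n m (f n m).
Proof. by rewrite /f; case: ex_minnP => h /asboolP. Qed.

Lemma f_le (n m h : nat) : has_multiples n m h -> f n m <= h.
Proof. by rewrite /f; case: ex_minnP => k _ kmin /asboolP /kmin. Qed.

Lemma exists_f_value (n : nat) :
  exists k, `[< exists2 m, 1 <= m & f n m = k >].
Proof. by exists (f n 1); apply/asboolP; exists 1. Qed.

Lemma f_value_bounded (n k : nat) :
  `[< exists2 m, 1 <= m & f n m = k >] -> k <= n * n.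
Proof. by move=> /asboolP[m _ <-]; apply/f_le/has_multiples_sqr. Qed.

Definition F (n : nat) : nat :=
  ex_maxn (exists_f_value n) (@f_value_bounded n).

Lemma F_attained (n : nat) : exists2 m, 1 <= m & f n m = F n.
Proof. by rewrite /F; case: ex_maxnP => k /asboolP. Qed.

Lemma f_le_F (n m : nat) : 1 <= m -> f n m <= F n.
Proof.
by move=> m1; rewrite /F; case: ex_maxnP => k _; apply; apply/asboolP; exists m.
Qed.

(* Main.v *)
Require Import Defs.
From mathcomp Require Import all_boot all_order all_algebra.
From mathcomp Require Import all_classical all_reals all_analysis.
From mathcomp Require Import fintype finset zify ring lra.

(* Lower bound for F. Let psi z y be the number of z-smooth integers up to y. If
   F n <= g h, the integers g s, with s <= n / g smooth, have distinct multiples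
   in (g w, g (w + h)], which are g times distinct multiples of the s in
   (w, w + h]; if w + h <= z s the cofactors are at most z, so these multiples are
   smooth. Hence (w, w + h] contains at least as many smooth integers as [Y / e, Y]
   does, where Y = e (w + h) / z and g = n / Y. Take windows whose endpoints are in
   geometric progression of ratio e^(1/k): every smooth s <= y is counted k times,
   and so k psi z y <= psi z (z y) for y < n / e. This needs F n to be at most about
   n z / (e k).
   On the other hand log x is the sum of log p over the prime powers p^a dividing
   x, which bounds log y * psi z y by a combination of the psi z (y / p^a). It
   follows that y^(-b) psi z y is maximal at some y <= Y0 as soon as the sum of
   log p / (p^b - 1) over p <= z is at most log Y0 - O(1), and at the maximum
   psi z (z y) <= z^b psi z y, a contradiction if k > z^b. So F n is at least about
   n z^(1-b) / e. One takes b small, Y0 = n^(1-o(1)) and z^(1-b) close to log n;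
   for well chosen z the sum over primes is about z^(1-b) / (1-b) by Mertens' first
   theorem, so the prime number theorem is not needed.

   Upper bound for f n n, which is o(n log n). If n / 2^(j+1) < i <= n / 2^j and
   j < J, take i 2^(2j+1), in (n 2^j, n 2^(j+1)]. The other i are matched with
   multiples i q in (n 2^J, n 2^(J+2)], q prime: an integer u is such a multiple of
   at most log2 u integers i, while by Chebyshev each i has many more than 2^J such
   multiples, since q ranges over the primes in (x, 4 x] for some x >= 4^J. So
   Hall's theorem applies with 2^J a small multiple of log n. *)

Set Implicit Arguments.
Unset Strict Implicit.
Unset Printing Implicit Defensive.
Import Order.TTheory GRing.Theory Num.Theory.

Local Open Scope nat_scope.

(** * Matchings in bipartite graphs *)

(** Rado's proof: elements are removed from the sets, keeping Hall's condition, until all are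
    singletons; the condition on pairs then makes these distinct. *)
Theorem hall_marriage (I T : finType) (A : I -> {set T}) :
  (forall J : {set I}, #|J| <= #|\bigcup_(i in J) A i|) ->
  exists2 g : I -> T, injective g & forall i, g i \in A i.
Proof.
have [N] := ubnP (\sum_i #|A i|); elim: N A => // N IHN A; rewrite ltnS => leN hallA.
have [/existsP[i0 /card_gt1P[x [y [xA yA xy]]]]|small] :=
  boolP [exists i, 1 < #|A i|]; last first.
  have A1 i : exists x, A i = [set x].
    apply/cards1P; rewrite eqn_leq.
    move: small; rewrite negb_exists => /forallP/(_ i); rewrite -leqNgt => -> /=.
    by have := hallA [set i]; rewrite cards1 big_set1.
  have A1' i : exists x, A i == [set x] by have [x ->] := A1 i; exists x.
  pose g i := xchoose (A1' i).
  have gE i : A i = [set g i] by exact: (eqP (xchooseP (A1' i))).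
  exists g => [i j gij|i]; last by rewrite gE set11.
  apply/eqP; apply: contraT => ij; have := hallA [set i; j].
  by rewrite cards2 ij bigcup_setU !big_set1 !gE gij setUid cards1.
(* Rado: one of x, y can be removed from A i0, otherwise submodularity of the
   cardinal contradicts the hypothesis. *)
pose B z i := if i == i0 then A i0 :\ z else A i.
have BsubA z i : B z i \subset A i.
  by rewrite /B; case: eqP => // ->; rewrite subsetDl.
have shrink z : z \in A i0 ->
    (forall J : {set I}, #|J| <= #|\bigcup_(i in J) B z i|) ->
    exists2 g : I -> T, injective g & forall i, g i \in A i.
  move=> zA hallB; have [|g ginj gB] := IHN (B z) _ hallB.
    apply: leq_trans leN; rewrite (bigD1 i0) //= [X in _ < X](bigD1 i0) //=.
    rewrite {1}/B eqxx [in X in _ < X](cardsD1 z) zA add1n addSn ltnS leq_add2l.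
    by apply: leq_sum => i _; exact/subset_leq_card/BsubA.
  by exists g => // i; exact: (subsetP (BsubA z i)).
have bad z : ~~ [forall J : {set I}, #|J| <= #|\bigcup_(i in J) B z i|] ->
    exists2 J : {set I}, i0 \in J & #|\bigcup_(i in J) B z i| < #|J|.
  rewrite negb_forall => /existsP[J]; rewrite -ltnNge => ltJ; exists J => //.
  apply: contraLR ltJ => i0J; rewrite -leqNgt; apply: leq_trans (hallA J) _.
  apply/subset_leq_card/bigcupsP => i iJ.
  have ->: A i = B z i by rewrite /B; case: eqP => // ii0; rewrite -ii0 iJ in i0J.
  exact: bigcup_sup.
have [/forallP|/bad[J1 i01 lt1]] :=
  boolP [forall J : {set I}, #|J| <= #|\bigcup_(i in J) B x i|]; first exact: shrink.
have [/forallP|/bad[J2 i02 lt2]] :=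
  boolP [forall J : {set I}, #|J| <= #|\bigcup_(i in J) B y i|]; first exact: shrink.
exfalso; set U1 := \bigcup_(i in J1) _ in lt1; set U2 := \bigcup_(i in J2) _ in lt2.
(* As [x != y], every element of [A i0] survives in [B x i0] or in [B y i0]. *)
have hU : #|J1 :|: J2| <= #|U1 :|: U2|.
  apply: leq_trans (hallA _) _; apply/subset_leq_card/bigcupsP => i.
  have [-> _|ii0] := eqVneq i i0.
    apply/subsetP => t tA; rewrite inE; apply/orP.
    have [tx|tx] := eqVneq t x; [right|left]; apply/bigcupP; exists i0 => //;
      by rewrite /B eqxx !inE ?tA ?andbT // tx xy.
  rewrite inE => /orP[iJ|iJ]; [apply: subset_trans (subsetUl _ _)|
    apply: subset_trans (subsetUr _ _)]; apply/subsetP => t tA;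
    by apply/bigcupP; exists i => //; rewrite /B (negbTE ii0).
(* Away from [i0] the sets [B x] and [B y] agree with [A]. Leaving [i0] out costs one, less than the
   two provided by [lt1] and [lt2]. *)
have hI : #|(J1 :&: J2) :\ i0| <= #|U1 :&: U2|.
  apply: leq_trans (hallA _) _; apply/subset_leq_card/bigcupsP => i.
  rewrite !inE => /and3P[ii0 iJ1 iJ2]; apply/subsetP => t tA; rewrite inE.
  by apply/andP; split; apply/bigcupP; exists i => //; rewrite /B (negbTE ii0).
have := cardsUI U1 U2; have := cardsUI J1 J2.
have := cardsD1 i0 (J1 :&: J2); rewrite inE i01 i02 /=; lia.
Qed.

(** Double counting: at least [d * #|J|] edges leave [J], and at most [d] of them end at each
    neighbour. *)
Corollary matching_of_degrees (I T : finType) (E : I -> T -> bool) (d : nat) :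
  0 < d -> (forall i, d <= #|[set t | E i t]|) ->
  (forall t, #|[set i | E i t]| <= d) ->
  exists2 g : I -> T, injective g & forall i, E i (g i).
Proof.
move=> d0 degI degT.
have [|g ginj gE] := @hall_marriage I T (fun i => [set t | E i t]); last first.
  by exists g => // i; have := gE i; rewrite inE.
move=> J; set N := \bigcup_(i in J) _; rewrite -(leq_pmul2r d0).
apply: (@leq_trans (\sum_(i in J) #|[set t | E i t]|)).
  by rewrite -sum_nat_const; exact: leq_sum.
have cardE i : i \in J -> #|[set t | E i t]| = \sum_(t in N) E i t.
  move=> iJ; rewrite -sum1_card big_mkcond [RHS]big_mkcond /=.
  apply: eq_bigr => t _; rewrite inE; case: (boolP (E i t)) => Eit; last by case: ifP.
  by rewrite ifT //; apply/bigcupP; exists i; rewrite ?inE.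
rewrite (eq_bigr _ cardE) exchange_big /= -sum_nat_const; apply: leq_sum => t _.
apply: leq_trans (degT t); rewrite -sum1_card big_mkcond [leqRHS]big_mkcond /=.
by apply: leq_sum => i _; rewrite inE; case: (i \in J); case: (E i t).
Qed.

(** * Primes between x and 4 x *)

Lemma prod_primes_dvd (N : nat) (s : seq nat) :
  uniq s -> all (fun p => prime p && (p %| N)) s -> \prod_(p <- s) p %| N.
Proof.
elim: s => [|p s IHs] /=; first by rewrite big_nil dvd1n.
case/andP=> ps us /andP[/andP[pp pN] ass]; rewrite big_cons Gauss_dvd ?pN ?IHs //.
rewrite big_seq; elim/big_rec: _ => [|q m qs cm]; first exact: coprimen1.
rewrite coprimeMr cm andbT prime_coprime // dvdn_prime2 //.
  by apply: contraNneq ps => ->.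
by case/andP: (allP ass _ qs).
Qed.

(** The coefficient occurs twice in the expansion of [(1 + 1) ^ (2 m + 1)]. *)
Lemma leq_bin_half (m : nat) : 'C(m.*2.+1, m) <= 4 ^ m.
Proof.
have binE : 'C(m.*2.+1, m.+1) = 'C(m.*2.+1, m).
  by rewrite -bin_sub; [congr 'C(_, _); lia|lia].
have : 'C(m.*2.+1, m) + 'C(m.*2.+1, m.+1) <= 2 ^ m.*2.+1.
  rewrite -[2]/(1 + 1) expnDn.
  have lt1 : m < m.*2.+2 by lia.
  have lt2 : m.+1 < m.*2.+2 by lia.
  rewrite (bigD1 (Ordinal lt1)) //= (bigD1 (Ordinal lt2)) /=; last first.
    by rewrite -val_eqE /=; lia.
  by rewrite !exp1n !muln1 addnA leq_addr.
by rewrite binE expnS -[in leqRHS]mul2n expnM (_ : 2 ^ 2 = 4) //; lia.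
Qed.

(** Induction of Erdos: an even [n > 2] adds no prime, and for [n = 2 m + 1] the primes in
    [(m + 1, n]] divide ['C(n, m)]. *)
Lemma leq_primorial (n : nat) : \prod_(0 <= p < n.+1 | prime p) p <= 4 ^ n.
Proof.
elim/ltn_ind: n => n IHn.
case: n IHn => [|[|[|n]]] IHn; try by rewrite unlock.
have [n_odd|n_even] := boolP (odd n.+3); last first.
  rewrite big_mkcond big_nat_recr //= ifF; last first.
    by apply/negP => /even_prime[//|]; rewrite (negbTE n_even).
  by rewrite muln1 -big_mkcond (leq_trans (IHn n.+2 _)) // leq_pexp2l.
pose m := (n.+1)./2.+1; have nE : n.+3 = m.*2.+1.
  by rewrite /m; move: n_odd; rewrite /=; lia.
rewrite nE (@big_cat_nat _ _ _ m.+2) //=; [|lia].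
have -> : 4 ^ m.*2.+1 = 4 ^ m.+1 * 4 ^ m by rewrite -expnD; congr (4 ^ _); lia.
apply: leq_mul; first by apply: IHn; lia.
apply: leq_trans (leq_bin_half m).
apply: dvdn_leq; first by rewrite bin_gt0; lia.
rewrite -big_filter; apply: prod_primes_dvd; first by rewrite filter_uniq ?iota_uniq.
apply/allP => p; rewrite mem_filter mem_index_iota => /and3P[pp mp pm].
rewrite pp /=.
have : p %| m.*2.+1`! by rewrite dvdn_fact // prime_gt0.
rewrite -(@bin_fact m.*2.+1 m); last by lia.
rewrite Euclid_dvdM // => /orP[//|]; rewrite Euclid_dvdM //.
have nd k : k < p -> p %| k`! -> False.
  move=> kp; rewrite fact_prod big_nat; elim/big_rec: _ => [|i x ik IH].
    by rewrite dvdn1 => /eqP p1; rewrite p1 in pp.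
  rewrite Euclid_dvdM // => /orP[/dvdn_leq|//]; lia.
by move=> /orP[] /nd; case; lia.
Qed.

Lemma leq_central_bin (n : nat) : 0 < n -> 4 ^ n <= n.*2 * 'C(n.*2, n).
Proof.
elim: n => // -[_ _|n /(_ isT)]; first by [].
move: n.+1 (ltn0Sn n) => m m0 IHm _.
have e1 : m.*2.+2 * 'C(m.*2.+1, m) = m.+1 * 'C(m.*2.+2, m.+1) by rewrite mul_bin_diag.
have e2 : m.*2.+1 * 'C(m.*2, m) = m.+1 * 'C(m.*2.+1, m).
  by rewrite (mul_bin_down m.*2.+1 m) (_ : m.*2.+1 - m = m.+1) //; lia.
rewrite expnS doubleS; nia.
Qed.

(** By Legendre's formula the exponent is the sum of [2 n %/ p ^ k - 2 (n %/ p ^ k)] over [k]; each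
    term is at most 1, and it vanishes once [p ^ k > 2 n]. *)
Lemma logn_central_bin (p n : nat) : prime p -> 0 < n ->
  logn p 'C(n.*2, n) <= trunc_log p n.*2.
Proof.
move=> pp n0; have p1 := prime_gt1 pp.
have le_n : n <= n.*2 by lia.
have C0 : 0 < 'C(n.*2, n) by rewrite bin_gt0.
have := bin_fact le_n; rewrite -addnn addnK addnn => /(congr1 (logn p)).
rewrite !lognM ?muln_gt0 ?fact_gt0 // !logn_fact //.
have ext : \sum_(1 <= k < n.+1) n %/ p ^ k = \sum_(1 <= k < n.*2.+1) n %/ p ^ k.
  rewrite [RHS](@big_cat_nat _ _ _ n.+1) //=.
  rewrite [X in _ = _ + X]big_nat_cond [X in _ = _ + X]big1 ?addn0 // => k.
  rewrite andbT => /andP[nk _]; apply: divn_small.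
  exact: leq_trans (ltnW (ltn_expl k p1)).
rewrite ext -big_split /= => logE.
have le1 : logn p 'C(n.*2, n) <= \sum_(1 <= k < n.*2.+1) (p ^ k <= n.*2).
  rewrite -(leq_add2r (\sum_(1 <= k < n.*2.+1) (n %/ p ^ k + n %/ p ^ k))) logE.
  rewrite -big_split /=; apply: leq_sum => k _.
  have pk0 : 0 < p ^ k by rewrite expn_gt0 ltnW.
  case: (leqP (p ^ k) n.*2) => [_|lt]; last by rewrite divn_small.
  have a := divn_eq n (p ^ k); have b := ltn_pmod n pk0.
  rewrite add1n -ltnS ltn_divLR //; move: a b; set q := n %/ _; set r := _ %% _.
  nia.
apply: leq_trans le1 _.
have tl : trunc_log p n.*2 <= n.*2.
  rewrite -ltnS -(ltn_exp2l _ _ p1).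
  apply: leq_ltn_trans (trunc_logP p1 _) _; first by lia.
  exact: ltn_trans (ltnSn _) (ltn_expl _ p1).
rewrite (@big_cat_nat _ _ _ (trunc_log p n.*2).+1) //=.
rewrite [X in _ + X]big_nat_cond [X in _ + X]big1 ?addn0; last first.
  move=> k; rewrite andbT => /andP[tk _]; rewrite leqNgt.
  by rewrite (leq_trans (trunc_log_ltn n.*2 p1)) // leq_pexp2l // ltnW.
apply: (@leq_trans (\sum_(1 <= k < (trunc_log p n.*2).+1) 1)).
  by apply: leq_sum => k _; exact: leq_b1.
by rewrite sum_nat_const_nat; lia.
Qed.

Definition nb_primes (a b : nat) : nat := \sum_(a <= p < b | prime p) 1.

(* The primes p with p ^ 2 <= 4 x contribute at most (4 x) ^ r to the central
   binomial coefficient, and the primes up to x at most 4 ^ x. *)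
Lemma nb_primes_bound (x r : nat) : 0 < x -> 4 * x < r.+1 ^ 2 ->
  4 ^ x <= (4 * x) ^ (r + nb_primes x.+1 (4 * x).+1).+1.
Proof.
move=> x0 xr; set c := nb_primes _ _.
have cb : 4 ^ (x.*2) <= (4 * x) * 'C(4 * x, x.*2).
  have := @leq_central_bin x.*2; have -> : (x.*2).*2 = 4 * x by lia.
  by apply; lia.
have C0 : 0 < 'C(4 * x, x.*2) by rewrite bin_gt0; lia.
have CE : 'C(4 * x, x.*2) <= \prod_(0 <= p < (4 * x).+1 | prime p)
    ((if p <= r then 4 * x else 1) * (if p <= x then p else 1) *
     (if x < p then 4 * x else 1)).
  have le_log p : prime p -> logn p 'C(4 * x, x.*2) <= trunc_log p (4 * x).
    move=> pp; have := @logn_central_bin p x.*2 pp.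
    have -> : (x.*2).*2 = 4 * x by lia.
    by apply; lia.
  have le_pow p : prime p -> p ^ logn p 'C(4 * x, x.*2) <= 4 * x.
    move=> pp; have p1 := prime_gt1 pp.
    apply: leq_trans (trunc_logP p1 _); last by lia.
    by rewrite leq_exp2l ?le_log.
  have le_p p : prime p -> p ^ logn p 'C(4 * x, x.*2) <=
      (if p <= r then 4 * x else 1) * (if p <= x then p else 1) *
      (if x < p then 4 * x else 1).
    move=> pp; have p1 := prime_gt1 pp; have lp := le_pow p pp.
    have [pr|rp] := leqP p r; first by case: ifP; case: ifP => *; nia.
    have : logn p 'C(4 * x, x.*2) <= 1.
      apply: leq_trans (le_log p pp) _; rewrite -ltnS -(ltn_exp2l _ _ p1).
      apply: leq_ltn_trans (trunc_logP p1 _) _; first by lia.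
      by apply: leq_trans xr _; rewrite leq_exp2r.
    move: lp; case: (logn p _) => [|[|//]]; rewrite ?expn0 ?expn1 => *.
      by case: ifP; case: ifP => *; nia.
    by case: ifP; case: ifP => *; lia.
  set M := maxn (4 * x) 'C(4 * x, x.*2).
  have -> : 'C(4 * x, x.*2) =
      \prod_(0 <= p < (4 * x).+1 | prime p) p ^ logn p 'C(4 * x, x.*2).
    rewrite -{1}(partnT C0) (@widen_partn M) ?leq_maxr //.
    rewrite (@big_cat_nat _ _ _ (4 * x).+1) ?ltnS ?leq_maxl //=.
    rewrite [X in _ * X]big_nat_cond [X in _ * X]big1 ?muln1; last first.
      move=> p /andP[/andP[xp _] _]; rewrite (_ : logn _ _ = 0) //.
      case pp : (prime p); last by rewrite lognE pp.
      apply/eqP; rewrite -leqn0 -ltnS -(ltn_exp2l _ _ (prime_gt1 pp)).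
      by apply: leq_ltn_trans (le_pow _ pp) _; rewrite expn1.
    rewrite [RHS]big_mkcond /=; apply: eq_bigr => p _.
    by case: ifP => // pp; rewrite lognE pp.
  by apply: leq_prod => p; exact: le_p.
have le1 : \prod_(0 <= p < (4 * x).+1 | prime p) (if p <= r then 4 * x else 1) <=
    (4 * x) ^ r.
  apply: (@leq_trans (\prod_(1 <= p < r.+1) (4 * x))); last first.
    by rewrite prod_nat_const_nat subn1.
  pose N := maxn (4 * x) r.
  have xN : (4 * x).+1 <= N.+1 by rewrite ltnS leq_maxl.
  have rN : r.+1 <= N.+1 by rewrite ltnS leq_maxr.
  rewrite (big_nat_widen _ _ _ _ _ xN) [leqRHS](big_nat_widen _ _ _ _ _ rN) /=.
  rewrite big_mkcond [leqRHS]big_mkcond big_ltn //= mul1n; apply: leq_prod => p _.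
  by rewrite !ltnS; case: (prime p); case: (p <= r); case: (p <= 4 * x) => /=; lia.
have le2 : \prod_(0 <= p < (4 * x).+1 | prime p) (if p <= x then p else 1) <= 4 ^ x.
  apply: leq_trans (leq_primorial x).
  rewrite (@big_cat_nat _ _ _ x.+1) /=; [|lia|lia].
  rewrite [X in _ * X]big_nat_cond [X in _ * X]big1 ?muln1.
    rewrite big_nat_cond [leqRHS]big_nat_cond; apply: leq_prod => p.
    by move=> /andP[/andP[_ px] _]; rewrite ifT.
  by move=> p /andP[/andP[xp _] _]; rewrite ifF // leqNgt xp.
have le3 : \prod_(0 <= p < (4 * x).+1 | prime p) (if x < p then 4 * x else 1) <=
    (4 * x) ^ c.
  rewrite (@big_cat_nat _ _ _ x.+1) /=; [|lia|lia].
  rewrite big_nat_cond big1 ?mul1n; last first.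
    by move=> p /andP[/andP[_ px] _]; rewrite ltnNge -ltnS px.
  rewrite /c /nb_primes (big_morph _ (expnD (4 * x)) (expn0 _)) /=.
  rewrite big_nat_cond [leqRHS]big_nat_cond; apply: leq_prod => p /andP[/andP[xp _] _].
  by rewrite xp expn1.
have : 4 ^ x.*2 <= (4 * x) * ((4 * x) ^ r * 4 ^ x * (4 * x) ^ c).
  apply: leq_trans cb _; rewrite leq_mul2l; apply/orP; right.
  by apply: leq_trans CE _; rewrite !big_split /= !leq_mul.
rewrite -addnn expnD expnS expnD; have : 0 < 4 ^ x by rewrite expn_gt0.
set A := 4 ^ x; set B := _ ^ r; set D := _ ^ c => A0 le.
by rewrite -(leq_pmul2r A0); apply: leq_trans le _; lia.
Qed.

(** With fewer primes, [nb_primes_bound] at [r = 2 ^ (j + 2)] would bound [4 ^ x] by a power of 4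
    with exponent at most [(j + 2) 2 ^ j (4 + 2 ^ K)], which is less than [4 ^ j <= x]. A count of
    order [sqrt x], with any constant, is all that the matching needs. *)
Lemma many_primes (K : nat) : exists J0, forall j x, J0 <= j ->
  4 ^ j <= x < 4 ^ j.+1 -> 2 ^ (K + j) <= nb_primes x.+1 (4 * x).+1.
Proof.
have [J0 J0P] : exists J0, forall j, J0 <= j -> (j + 2) * (5 + 2 ^ K) < 2 ^ j.
  exists (6 * (5 + 2 ^ K)) => j; set A := 5 + 2 ^ K => Aj.
  have lt_h := ltn_expl j./2 (isT : 1 < 2).
  have : 2 ^ j./2 * 2 ^ j./2 <= 2 ^ j by rewrite -expnD leq_exp2l //; lia.
  by move: (2 ^ j./2) lt_h => B; nia.
exists J0 => j x /J0P jK /andP[jx xj].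
rewrite leqNgt; apply/negP => lt_c.
have x0 : 0 < x by apply: leq_trans jx; rewrite expn_gt0.
have le4 k : 2 ^ k.*2 = 4 ^ k by rewrite -mul2n expnM.
have xr : 4 * x < (2 ^ (j + 2)).+1 ^ 2.
  apply: leq_trans (_ : (2 ^ (j + 2)) ^ 2 <= _); last by rewrite leq_exp2r.
  by rewrite -expnM muln2 le4 addn2 [in leqRHS]expnS ltn_pmul2l.
have := nb_primes_bound x0 xr; apply/negP; rewrite -ltnNge.
set c := nb_primes _ _ in lt_c *.
apply: (@leq_ltn_trans (4 ^ ((j + 2) * (2 ^ (j + 2) + c).+1))).
  by rewrite expnM leq_exp2r // addn2 expnS leq_pmul2l // ltnW.
rewrite ltn_exp2l //; apply: leq_trans jx.
have lt_c' : c.+1 <= 2 ^ K * 2 ^ j by rewrite -expnD.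
rewrite -le4 -addnn !expnD; nia.
Qed.

(** * The upper bound for f n n *)

Lemma nb_primesE (a b : nat) :
  nb_primes a b = size [seq p <- index_iota a b | prime p].
Proof. by rewrite -sum1_size big_filter. Qed.

Lemma exp2_size_primes (u : nat) : 0 < u -> 2 ^ size (primes u) <= u.
Proof.
move=> u0; apply: (@leq_trans (\prod_(p <- primes u) p)); last first.
  apply: dvdn_leq => //; apply: prod_primes_dvd (primes_uniq u) _.
  by apply/allP => p; rewrite mem_primes => /and3P[-> _ ->].
have : all (leq 2) (primes u).
  by apply/allP => p; rewrite mem_primes => /and3P[/prime_gt1].
elim: (primes u) => [|p s IHs] /=; first by rewrite big_nil.
by case/andP=> p2 /IHs; rewrite big_cons expnS; exact: leq_mul.
Qed.

(** Each [i] is joined to the [i q], [q] a prime in [(x, 4 x]] where [x = n 2 ^ J / i >= 4 ^ J].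
    Given [u], the prime [q] determines [i], so [u] has at most as many neighbours as prime factors,
    and [u < 2 ^ d]. *)
Lemma matching_small (n J d : nat) : 0 < n -> 0 < d ->
  (forall x, 4 ^ J <= x -> d <= nb_primes x.+1 (4 * x).+1) ->
  n * 2 ^ (J + 2) < 2 ^ d ->
  exists a : nat -> nat,
    (forall i j, 0 < i -> i * 2 ^ J <= n -> 0 < j -> j * 2 ^ J <= n ->
      a i = a j -> i = j) /\
    (forall i, 0 < i -> i * 2 ^ J <= n ->
      (n * 2 ^ J < a i <= n * 2 ^ (J + 2)) && (i %| a i)).
Proof.
move=> n0 d0 manyP ltd; set U := n * 2 ^ (J + 2) in ltd *.
pose m := n %/ 2 ^ J; have J0 : 0 < 2 ^ J by rewrite expn_gt0.
(* The ordinal [i] stands for the integer [i + 1]. *)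
pose x (i : nat) := (n * 2 ^ J) %/ i.+1.
pose E (i : 'I_m) (u : 'I_U.+1) :=
  [&& i.+1 %| u, prime (u %/ i.+1) & x i < u %/ i.+1 <= 4 * x i].
have x4 (i : 'I_m) : 4 ^ J <= x i.
  rewrite /x leq_divRL // -[4]/(2 ^ 2) -expnM mul2n -addnn expnD.
  by have := ltn_ord i; rewrite {2}/m leq_divRL // => im;
    rewrite -mulnA (mulnC n) leq_mul2l mulnC im orbT.
have le4 (i : 'I_m) : i.+1 * (4 * x i) <= U.
  by rewrite /U /x expnD; have := leq_divM (n * 2 ^ J) i.+1; lia.
have [i|u|g ginj gE] := @matching_of_degrees _ _ E d d0.
- apply: leq_trans (manyP _ (x4 i)) _; rewrite nb_primesE.
  set s := [seq p <- _ | _].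
  have us : uniq s by rewrite filter_uniq // iota_uniq.
  have sP q : q \in s -> prime q /\ x i < q <= 4 * x i.
    by rewrite mem_filter mem_index_iota => /andP[].
  have vE q : q \in s -> (inord (i.+1 * q) : 'I_U.+1) = i.+1 * q :> nat.
    move=> /sP[_ /andP[_ q4]]; rewrite inordK // ltnS (leq_trans _ (le4 i)) //.
    by rewrite leq_mul2l q4.
  rewrite cardE -(size_map (fun q => inord (i.+1 * q) : 'I_U.+1)).
  apply: uniq_leq_size.
    rewrite map_inj_in_uniq // => q q' qs q's /(congr1 val) /=.
    by rewrite !vE // => /eqP; rewrite eqn_pmul2l // => /eqP.
  move=> _ /mapP[q qs ->]; have [pq xq] := sP q qs.
  by rewrite mem_enum inE /E vE // dvdn_mulr //= mulKn // pq.
- have [u0|u0] := posnP u.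
    (* The vertex [0] is isolated: its quotients are [0], which is not prime. *)
    rewrite (_ : [set i | E i u] = set0) ?cards0 //.
    by apply/setP => i; rewrite !inE /E u0 div0n andbF.
  apply: (@leq_trans (size (primes u))); last first.
    rewrite -ltnS -(ltn_exp2l _ _ (isT : 1 < 2)).
    apply: leq_ltn_trans (exp2_size_primes u0) _.
    apply: leq_ltn_trans (_ : U < _); first by rewrite -ltnS.
    by apply: ltn_trans ltd _; rewrite ltn_exp2l.
  rewrite cardE -(size_map (fun i : 'I_m => u %/ i.+1)); apply: uniq_leq_size.
    rewrite map_inj_in_uniq ?enum_uniq // => i j.
    rewrite !mem_enum !inE => /and3P[iu pi _] /and3P[ju pj _] eij.
    apply/val_inj; apply: succn_inj; apply/eqP.
    rewrite -(eqn_pmul2l (prime_gt0 pi)) {2}eij !divnK //.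
  move=> v /mapP[i]; rewrite mem_enum inE => /and3P[iu pi _] ->.
  by rewrite mem_primes pi u0 dvdn_div.
have im i : 0 < i -> i * 2 ^ J <= n -> i.-1 < m.
  by move=> i0 iJ; rewrite prednK // /m leq_divRL.
pose a i : nat := if @insub _ _ 'I_m i.-1 is Some k then g k else 0.
have aE i (h : i.-1 < m) : a i = g (Ordinal h) by rewrite /a insubT.
exists a; split=> [i j i0 iJ j0 jJ|i i0 iJ].
  rewrite (aE i (im i i0 iJ)) (aE j (im j j0 jJ)) => /val_inj/ginj/(congr1 val) /=.
  lia.
rewrite (aE i (im i i0 iJ)); have := gE (Ordinal (im i i0 iJ)).
case: (g _) => u /= uU; rewrite /E /x /= prednK //.
move=> /and3P[iu pi /andP[lt_u _]]; rewrite -(ltnS u) uU iu !andbT.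
by rewrite -{1}(divnK iu) -ltn_divLR.
Qed.

(** [J] is such that [2 ^ (K + J)] lies between [l] and [2 l]. The large [i] get multiples in
    [(n, n 2 ^ J]] and the small ones multiples in [(n 2 ^ J, n 2 ^ (J + 2)]]. *)
Lemma f_diag_bound (K : nat) :
  exists N, forall n, N <= n -> f n n * 2 ^ K <= 8 * (n * trunc_log 2 n).
Proof.
have [J0 J0P] := many_primes K.+1.
(* This threshold forces [l >= 2 ^ (K + J0 + 3)], whence [J >= J0] below. *)
exists (2 ^ (2 ^ (K + J0 + 3))) => n Nn; set l := trunc_log 2 n.
have n0 : 0 < n by apply: leq_trans Nn; rewrite expn_gt0.
have lt_n : n < 2 ^ l.+1 by exact: trunc_log_ltn.
have Kl : 2 ^ (K + J0 + 3) <= l.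
  by rewrite -ltnS -(ltn_exp2l _ _ (isT : 1 < 2)) (leq_ltn_trans Nn).
have l0 : 0 < l by apply: leq_trans Kl; rewrite expn_gt0.
set e := (trunc_log 2 l).+1; have lt_l : l < 2 ^ e by exact: trunc_log_ltn.
have le_e : 2 ^ e <= 2 * l by rewrite expnS leq_mul2l trunc_logP.
have Ke : K + J0 + 3 < e.
  by rewrite -(ltn_exp2l _ _ (isT : 1 < 2)) (leq_ltn_trans Kl).
pose J := e - K; have eE : e = K + J by rewrite /J; lia.
have J1 : 0 < 2 ^ J by rewrite expn_gt0.
suff le_f : f n n <= n * 2 ^ (J + 2).
  apply: leq_trans (leq_mul le_f (leqnn _)) _.
  rewrite -mulnA -expnD (_ : J + 2 + K = e + 2); last by lia.
  by rewrite expnD (_ : 2 ^ 2 = 4) //; nia.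
(* The degree is [2 ^ (e + 1) > 2 l], which leaves room for the binary logarithm of
   [n * 2 ^ (J + 2)]. *)
have [|x J4||a [ainj aP]] := @matching_small n J (2 ^ (K.+1 + J)) n0.
- by rewrite expn_gt0.
- have x0 : 0 < x by apply: leq_trans J4; rewrite expn_gt0.
  have Jj : J <= trunc_log 4 x.
    by rewrite -ltnS -(ltn_exp2l _ _ (isT : 1 < 4)) (leq_ltn_trans J4) ?trunc_log_ltn.
  apply: leq_trans (J0P (trunc_log 4 x) x _ _).
  + by rewrite leq_exp2l // leq_add2l.
  + by apply: leq_trans Jj; lia.
  + by rewrite trunc_logP // trunc_log_ltn.
- apply: (@leq_trans (2 ^ l.+1 * 2 ^ (J + 2))); first by rewrite ltn_pmul2r ?expn_gt0.
  rewrite -expnD leq_exp2l // (addSn K J) -eE expnS.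
  have e0 : 1 < e by lia.
  have : e.-1 < 2 ^ e.-1 by exact: ltn_expl.
  have : 2 ^ e = 2 * 2 ^ e.-1 by rewrite -expnS prednK //; lia.
  lia.
apply: f_le.
(* For [j = j i] one has [n / 2 ^ (j + 1) < i <= n / 2 ^ j]. Distinct values of [j] put the [b i] in
   disjoint blocks, and [b] is injective for each fixed [j]. *)
pose j i := trunc_log 2 (n %/ i).
have jP i : 0 < i <= n -> i * 2 ^ j i <= n < i * 2 ^ (j i).+1.
  move=> /andP[i0 iin]; rewrite mulnC -leq_divRL // trunc_logP ?divn_gt0 //=.
  by rewrite mulnC -ltn_divLR // trunc_log_ltn.
pose b i := i * 2 ^ (j i + (j i).+1).
have bP i : 0 < i <= n -> n * 2 ^ j i < b i <= n * 2 ^ (j i).+1.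
  move=> /jP/andP[lo hi]; rewrite /b; apply/andP; split.
    by rewrite addnC expnD mulnA ltn_pmul2r ?expn_gt0.
  by rewrite expnD mulnA leq_mul2r lo orbT.
have jJ i : 0 < i <= n -> n < i * 2 ^ J -> j i < J.
  move=> ii ni; rewrite -(ltn_exp2l _ _ (isT : 1 < 2)); have := jP i ii.
  by have := andP ii; nia.
have bJ i : 0 < i <= n -> n < i * 2 ^ J -> n < b i <= n * 2 ^ J.
  move=> ii ni; have ji := jJ i ii ni; have /andP[lo hi] := bP i ii.
  apply/andP; split; first by apply: leq_ltn_trans lo; rewrite leq_pmulr ?expn_gt0.
  by apply: leq_trans hi _; rewrite leq_mul2l leq_exp2l // ji orbT.
have bmono i k : 0 < i <= n -> 0 < k <= n -> j i < j k -> b i < b k.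
  move=> ii kk jik; have /andP[_ hi] := bP i ii; have /andP[lo _] := bP k kk.
  by apply: leq_ltn_trans lo; apply: leq_trans hi _; rewrite leq_mul2l leq_exp2l ?jik ?orbT.
have binj i k : 0 < i <= n -> 0 < k <= n -> b i = b k -> i = k.
  move=> ii kk eb; have [jik|jki|jE] := ltngtP (j i) (j k).
  - by have := bmono i k ii kk jik; rewrite eb ltnn.
  - by have := bmono k i kk ii jki; rewrite eb ltnn.
  by apply/eqP; move/eqP: eb; rewrite /b jE eqn_pmul2r ?expn_gt0.
have aJ i : 0 < i -> i * 2 ^ J <= n -> n * 2 ^ J < a i.
  by move=> i0 iJ; case/andP: (aP i i0 iJ) => /andP[].
exists (fun i => if i * 2 ^ J <= n then a i else b i); split=> [i k ii kk|i ii].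
  have [i0 _] := andP ii; have [k0 _] := andP kk.
  case: leqP => iJ; case: leqP => kJ; first exact: ainj.
  - by move=> ab; have := aJ i i0 iJ; have := bJ k kk kJ; rewrite ab; lia.
  - by move=> ab; have := aJ k k0 kJ; have := bJ i ii iJ; rewrite ab; lia.
  exact: binj.
have [i0 _] := andP ii; case: (leqP (i * 2 ^ J) n) => iJ.
  have /andP[/andP[lo hi] ->] := aP i i0 iJ; rewrite andbT.
  by rewrite (leq_ltn_trans _ lo) ?leq_pmulr //= (leq_trans hi) ?leq_addl.
have /andP[lo hi] := bJ i ii iJ; rewrite lo dvdn_mulr // andbT /=.
by rewrite (leq_trans hi) // expnD; nia.
Qed.

(** * Smooth integers *)

(** As [primes 0] is empty, [0] has to be excluded explicitly. *)
Definition smooth (z x : nat) : bool := (0 < x) && all (leq^~ z) (primes x).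

Lemma smoothP (z x : nat) :
  reflect (0 < x /\ forall p, prime p -> p %| x -> p <= z) (smooth z x).
Proof.
apply: (iffP andP) => [[x0 /allP xz]|[x0 xz]]; split=> //.
  by move=> p pp px; apply: xz; rewrite mem_primes pp x0.
by apply/allP => p; rewrite mem_primes => /and3P[pp _ px]; exact: xz.
Qed.

Lemma smooth_le (z t : nat) : 0 < t <= z -> smooth z t.
Proof.
by move=> /andP[t0 tz]; apply/smoothP; split=> // p _ /(dvdn_leq t0)/leq_trans; apply.
Qed.

Lemma smoothM (z a b : nat) : smooth z a -> smooth z b -> smooth z (a * b).
Proof.
move=> /smoothP[a0 az] /smoothP[b0 bz]; apply/smoothP.
by rewrite muln_gt0 a0; split=> // p pp; rewrite Euclid_dvdM // => /orP[/az|/bz]; apply.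
Qed.

Lemma smooth_dvd (z a b : nat) : a %| b -> smooth z b -> smooth z a.
Proof.
move=> ab /smoothP[b0 bz]; apply/smoothP; rewrite (dvdn_gt0 b0 ab); split=> // p pp pa.
by apply: bz => //; exact: dvdn_trans ab.
Qed.

Definition psi (z y : nat) : nat := \sum_(1 <= x < y.+1 | smooth z x) 1.

Lemma sum1_le_inj (m n m' n' : nat) (P Q : pred nat) (g : nat -> nat) :
  (forall x, m <= x < n -> P x -> m' <= g x < n' /\ Q (g x)) ->
  (forall x y, m <= x < n -> P x -> m <= y < n -> P y -> g x = g y -> x = y) ->
  \sum_(m <= x < n | P x) 1 <= \sum_(m' <= y < n' | Q y) 1.
Proof.
move=> gP ginj; rewrite -[leqLHS]big_filter -[leqRHS]big_filter !sum1_size -(size_map g).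
apply: uniq_leq_size.
  rewrite map_inj_in_uniq ?filter_uniq ?iota_uniq // => x y.
  rewrite !mem_filter !mem_index_iota => /andP[Px xmn] /andP[Py ymn]; exact: ginj.
move=> v /mapP[x]; rewrite mem_filter mem_index_iota => /andP[Px xmn] ->.
by have [h1 h2] := gP x xmn Px; rewrite mem_filter mem_index_iota h1 h2.
Qed.

Lemma psi_dvd (z y q : nat) : 0 < q ->
  \sum_(1 <= x < y.+1 | smooth z x && (q %| x)) 1 <= psi z (y %/ q).
Proof.
move=> q0; apply: (@sum1_le_inj _ _ _ _ _ _ (fun x => x %/ q)).
  move=> x /andP[x0 xy] /andP[sx qx]; rewrite ltnS leq_div2r // divn_gt0 // dvdn_leq //.
  by split=> //; apply: smooth_dvd sx; rewrite dvdn_div.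
by move=> x y' _ /andP[_ qx] _ /andP[_ qy] e; rewrite -(divnK qx) e divnK.
Qed.

Lemma psi_pow2 (z y i : nat) :
  \sum_(1 <= x < y.+1 | smooth z x && (2 ^ i * x <= y)) 1 <= psi z (y %/ 2 ^ i).
Proof.
apply: (@sum1_le_inj _ _ _ _ _ _ id) => // x /andP[x0 xy] /andP[sx ix]; split=> //.
by rewrite x0 ltnS leq_divRL ?expn_gt0 // mulnC.
Qed.

Lemma psi_gt0 (z y : nat) : 0 < y -> 0 < psi z y.
Proof. by move=> y0; rewrite /psi big_mkcond big_ltn. Qed.

Lemma psi_cat (z y y' : nat) : y <= y' ->
  psi z y' = psi z y + \sum_(y.+1 <= u < y'.+1 | smooth z u) 1.
Proof. by move=> yy'; rewrite /psi (@big_cat_nat _ _ _ y.+1). Qed.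

Lemma psi_mono (z y y' : nat) : y <= y' -> psi z y <= psi z y'.
Proof. by move=> yy'; rewrite (psi_cat z yy') leq_addr. Qed.

(* Multiples of g s in (g w, g (w + h)] are g times multiples of s in (w, w + h],
   and the cofactor of s in such a multiple is at most z, hence smooth. *)
Lemma psi_window (n g w h z : nat) : 0 < g -> 0 < w -> F n <= g * h ->
  \sum_(1 <= s < (n %/ g).+1 | smooth z s && (w + h <= z * s)) 1 + psi z w <=
  psi z (w + h).
Proof.
move=> g0 w0 Fn; rewrite (psi_cat z (leq_addr h w)) addnC leq_add2l.
have [a [ainj aP]] := has_multiples_f n (g * w).
have fF : f n (g * w) <= g * h by apply: leq_trans (f_le_F _ _) Fn; rewrite muln_gt0 g0.
have gs s : 1 <= s < (n %/ g).+1 -> 1 <= g * s <= n.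
  by move=> /andP[s0 sn]; rewrite muln_gt0 g0 s0 mulnC -leq_divRL.
have ga s : 1 <= s < (n %/ g).+1 -> g * (a (g * s) %/ g) = a (g * s).
  by move=> /gs/aP/andP[_ d]; rewrite mulnC divnK // (dvdn_trans _ d) // dvdn_mulr.
apply: (@sum1_le_inj _ _ _ _ _ _ (fun s => a (g * s) %/ g)) => [s sn|s s' sn _ sn' _ e].
  move=> /andP[ss whs]; have /andP[/andP[lo hi] ds] := aP _ (gs s sn).
  have e := ga s sn; set u := _ %/ g in e *; rewrite -e in lo hi ds.
  rewrite ltn_pmul2l // in lo; rewrite dvdn_pmul2l // in ds.
  have uh : u <= w + h by rewrite -(leq_pmul2l g0) mulnDr; lia.
  split; first by rewrite lo.
  rewrite -(divnK ds) mulnC; apply: smoothM => //; apply: smooth_le.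
  have s0 : 0 < s by case/andP: sn.
  rewrite divn_gt0 // dvdn_leq ?(leq_ltn_trans _ lo) //=.
  by rewrite -(leq_pmul2r s0) divnK // (leq_trans uh).
have := ainj _ _ (gs s sn) (gs s' sn').
by rewrite -(ga s sn) -(ga s' sn') e => /(_ erefl)/eqP; rewrite eqn_pmul2l // => /eqP.
Qed.

Local Open Scope ring_scope.

(** * Sums over primes *)

Section Mertens.
Context {R : realType}.
Implicit Types (N n p q x z : nat).

Lemma ln_nat_ge0 n : 0 <= ln n%:R :> R.
Proof. by case: n => [|n]; [rewrite ln0|rewrite ln_ge0 // ler1n]. Qed.

Lemma ln_prime_sum x z : (0 < x)%N -> (forall p, prime p -> (p %| x)%N -> (p <= z)%N) ->
  ln x%:R = \sum_(0 <= p < z.+1 | prime p) (logn p x)%:R * ln p%:R :> R.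
Proof.
move=> x0 xz.
have -> : x%:R = expR (\sum_(0 <= p < z.+1 | prime p) (logn p x)%:R * ln p%:R) :> R;
  last by rewrite expRK.
rewrite expR_sum; transitivity (\prod_(0 <= p < z.+1 | prime p) (p ^ logn p x)%:R : R).
  rewrite -natr_prod; congr _%:R; rewrite -{1}(partnT x0).
  rewrite (@widen_partn (maxn x z)) ?leq_maxl // (@big_cat_nat _ _ _ z.+1) ?ltnS ?leq_maxr //=.
  rewrite [X in (_ * X)%N]big_nat_cond [X in (_ * X)%N]big1 ?muln1; last first.
    move=> p /andP[/andP[zp _] _]; rewrite (_ : logn _ _ = 0)%N //.
    apply/eqP; rewrite lognE; case: ifP => // /and3P[pp _ px].
    by have := xz p pp px; rewrite leqNgt zp.
  rewrite [RHS]big_mkcond /=; apply: eq_bigr => p _.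
  by case: ifP => // pp; rewrite lognE pp.
apply: eq_bigr => p pp; rewrite expRM_natl lnK ?natrX //.
by rewrite posrE ltr0n prime_gt0.
Qed.

Lemma geometric_le (r : R) n : 0 <= r < 1 -> \sum_(1 <= k < n) r ^+ k <= r / (1 - r).
Proof.
move=> /andP[r0 r1]; rewrite ler_pdivlMr ?subr_gt0 //.
suff : \sum_(1 <= k < n.+1) r ^+ k * (1 - r) <= r.
  rewrite -mulr_suml; apply: le_trans; rewrite ler_wpM2r ?subr_ge0 1?(ltW r1) //.
  case: n => [|n]; first by rewrite !big_geq ?lexx.
  by rewrite [leRHS]big_nat_recr //= lerDl exprn_ge0.
rewrite big_add1 /=.
suff -> : \sum_(0 <= k < n) r ^+ k.+1 * (1 - r) = r - r ^+ n.+1.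
  by rewrite lerBlDr lerDl exprn_ge0.
elim: n => [|n IHn]; first by rewrite big_geq // expr1 subrr.
by rewrite big_nat_recr //= IHn !exprS; ring.
Qed.

Definition mertens N : R := \sum_(0 <= p < N.+1 | prime p) ln p%:R / p%:R.

Lemma ln_fact N :
  ln (N`!)%:R = \sum_(0 <= p < N.+1 | prime p) (logn p N`!)%:R * ln p%:R :> R.
Proof.
apply: ln_prime_sum => [|p pp pN]; first exact: fact_gt0.
move: pN; rewrite fact_prod big_nat; elim/big_rec: _ => [|i y iN IH].
  by rewrite dvdn1 => /eqP p1; rewrite p1 in pp.
by rewrite Euclid_dvdM // => /orP[/dvdn_leq|/IH//]; lia.
Qed.

(** A prime [p <= N] has exponent at least [N D / p - 1] in the factorial of [N D], and the lost
    unit is at most the fraction [1 / D] of [N D / p]. *)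
Lemma mertens_le N D : (0 < N)%N -> (0 < D)%N ->
  (1 - D%:R^-1) * mertens N <= ln (N * D)%:R.
Proof.
move=> N0 D0; set Q := (N * D)%N; have Q0 : (0 < Q)%N by rewrite muln_gt0 N0.
have NQ : (N <= Q)%N by rewrite leq_pmulr.
have Qr : 0 < Q%:R :> R by rewrite ltr0n.
have upper : ln (Q`!)%:R <= Q%:R * ln Q%:R :> R.
  rewrite mulr_natl -lnXn // ler_ln ?posrE ?ltr0n ?fact_gt0 ?exprn_gt0 //.
  rewrite -natrX ler_nat fact_prod.
  have -> : (Q ^ Q = \prod_(1 <= i < Q.+1) Q)%N by rewrite prod_nat_const_nat subn1.
  by rewrite big_nat [leqRHS]big_nat; apply: leq_prod => i /andP[].
rewrite -(ler_pM2l Qr); apply: le_trans upper; rewrite ln_fact.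
rewrite (@big_cat_nat _ _ _ N.+1) //=.
apply: le_trans (_ : _ <= \sum_(0 <= p < N.+1 | prime p)
  (logn p Q`!)%:R * ln p%:R) _; last first.
  by rewrite lerDl sumr_ge0 // => p _; rewrite mulr_ge0 ?ln_nat_ge0.
rewrite mulrA /mertens mulr_sumr big_nat_cond [leRHS]big_nat_cond.
apply: ler_sum => p /andP[/andP[_ pN] pp].
have p0 : 0 < p%:R :> R by rewrite ltr0n prime_gt0.
rewrite [leLHS]mulrA [leLHS]mulrAC ler_wpM2r ?ln_nat_ge0 //.
apply: (@le_trans _ _ (Q %/ p)%:R); last first.
  rewrite ler_nat logn_fact // big_ltn // expn1.
  by apply: leq_trans (leq_addr _ _).
have : Q%:R < ((Q %/ p)%:R + 1) * p%:R :> R.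
  by rewrite natr1 -natrM ltr_nat -ltn_divLR ?prime_gt0.
have : p%:R <= N%:R :> R by rewrite ler_nat.
rewrite ler_pdivrMr // /Q natrM.
have D0r : 0 < D%:R :> R by rewrite ltr0n.
have -> : N%:R * D%:R * (1 - D%:R^-1) = N%:R * D%:R - N%:R :> R.
  by field; rewrite lt0r_neq0.
nra.
Qed.

(** The right-hand side telescopes from the value 2 at [m = 1], so the sum of [ln p / (p (p - 1))]
    is at most 2. *)
Lemma ln_nat_le_prod m : (0 < m)%N ->
  ln m.+1%:R / (m.+1%:R * m%:R) <= (ln m%:R + 2) / m%:R - (ln m.+1%:R + 2) / m.+1%:R :> R.
Proof.
move=> m0; have mr : 1 <= m%:R :> R by rewrite ler1n.
have -> : m.+1%:R = m%:R + 1 :> R by rewrite -natr1.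
move: (m%:R) mr => x x1; have x0 : 0 < x by lra.
have lnx : ln (x + 1) <= ln x + x^-1.
  have -> : x + 1 = x * (1 + x^-1) by field; lra.
  rewrite lnM ?posrE ?lerD2l; [|lra|by rewrite addr_gt0 ?invr_gt0].
  by rewrite -[leRHS]expRK ler_ln ?posrE ?expR_gt0 ?expR_ge1Dx ?addr_gt0 ?invr_gt0.
rewrite -subr_ge0.
have -> : (ln x + 2) / x - (ln (x + 1) + 2) / (x + 1) - ln (x + 1) / ((x + 1) * x) =
   ((ln x + 2) * (x + 1) - (ln (x + 1) + 2) * x - ln (x + 1)) / (x * (x + 1)).
  by field; lra.
rewrite divr_ge0 //; last by rewrite mulr_ge0; lra.
have : ln (x + 1) * (x + 1) <= (ln x + x^-1) * (x + 1) by rewrite ler_wpM2r; lra.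
have -> : (ln x + x^-1) * (x + 1) = ln x * (x + 1) + 1 + x^-1 by field; lra.
have : x^-1 <= 1 by rewrite invf_le1.
lra.
Qed.

(** Legendre's formula bounds the logarithm of N! by [N] times the sum of [ln p / (p - 1)]. Here
    [1 / (p - 1)] is [1 / p + 1 / (p (p - 1))], and the second part contributes at most 2. *)
Lemma mertens_ge N : (0 < N)%N -> ln N%:R - 3 <= mertens N.
Proof.
move=> N0; have Nr : 0 < N%:R :> R by rewrite ltr0n.
have lower : N%:R * ln N%:R - N%:R <= ln (N`!)%:R :> R.
  rewrite -ler_expR lnK ?posrE ?ltr0n ?fact_gt0 // expRB expRM_natl lnK //.
  rewrite ler_pdivrMr ?expR_gt0 // -ler_pdivrMl ?ltr0n ?fact_gt0 // mulrC.
  (* One term of the exponential series at [N] gives [N ^ N <= N! e ^ N]. *)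
  have := @expR_ge1Dxn R N%:R N.-1 (ltW Nr); rewrite prednK //; lra.
have upper : ln (N`!)%:R <= N%:R * (mertens N + 2).
  rewrite ln_fact.
  apply: (@le_trans _ _ (\sum_(0 <= p < N.+1 | prime p)
    N%:R * (ln p%:R / p%:R + ln p%:R / (p%:R * p.-1%:R)))).
    apply: ler_sum => p pp; have p1 := prime_gt1 pp.
    have p1r : 1 < p%:R :> R by rewrite ltr1n.
    have -> : ln p%:R / p%:R + ln p%:R / (p%:R * p.-1%:R) =
        ln p%:R * (p%:R^-1 / (1 - p%:R^-1)) :> R.
      rewrite -subn1 natrB ?prime_gt0 //; field; lra.
    rewrite mulrCA mulrC ler_wpM2l ?ln_nat_ge0 // logn_fact // natr_sum.
    apply: (@le_trans _ _ (N%:R * \sum_(1 <= k < N.+1) p%:R^-1 ^+ k)).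
      rewrite mulr_sumr; apply: ler_sum => k _; rewrite exprVn -natrX.
      have pk0 : (0 < p ^ k)%N by rewrite expn_gt0 ltnW.
      by rewrite ler_pdivlMr ?ltr0n // -natrM ler_nat leq_divM.
    rewrite ler_pM2l //; apply: geometric_le.
    by rewrite invr_ge0 invf_lt1 ?p1r; lra.
  rewrite -mulr_sumr big_split /= ler_pM2l // lerD2l.
  suff : \sum_(0 <= p < N.+1 | prime p) ln p%:R / (p%:R * p.-1%:R) <=
      2 - (ln N%:R + 2) / N%:R :> R.
    move=> h; apply: le_trans h _; rewrite lerBlDr lerDl divr_ge0 ?ltW //.
    by rewrite ltr_wpDl ?ln_nat_ge0.
  have step (S A B c : R) (b : bool) : 0 <= c -> c <= A - B -> S <= 2 - A ->
      S + (if b then c else 0) <= 2 - B by case: b => *; lra.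
  elim: N N0 {Nr lower} => // -[_ _|N IHN _].
    by rewrite unlock /= ln1 add0r divr1 subrr.
  have := IHN isT; have := @ln_nat_le_prod N.+1 isT.
  have : 0 <= ln N.+2%:R / (N.+2%:R * N.+1%:R) :> R by rewrite divr_ge0 ?ln_nat_ge0.
  rewrite [X in _ -> _ -> _ -> X <= _]big_mkcond big_nat_recr //= -big_mkcond /=.
  exact: step.
have : N%:R * ln N%:R - N%:R <= N%:R * (mertens N + 2) by exact: le_trans upper.
rewrite -[X in _ - X]mulr1 -mulrBr ler_pM2l //; lra.
Qed.
End Mertens.

(** * Sums of [ln p] times powers of [p], up to well-chosen bounds *)

Section PrimeSums.
Context {R : realType}.
Implicit Types (N n p q x z : nat) (b g t eps : R).

Lemma ln_le_subr1 (x : R) : 0 < x -> ln x <= x - 1.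
Proof.
move=> x0; rewrite -ler_expR lnK //.
by apply: le_trans (expR_ge1Dx _); rewrite addrC subrK.
Qed.

(** With [u] the right-hand side, [ln t <= t - 1] is used at [t = x / u] and [t = 1 / u] with
    weights [g] and [1 - g], for which the average of [t - 1] is zero. *)
Lemma bernoulli_powR (x g : R) : 0 <= x -> 0 < g <= 1 -> x `^ g <= 1 + g * (x - 1).
Proof.
rewrite le_eqVlt => /orP[/eqP <-|x0] /andP[g0 g1].
  by rewrite powR0 ?lt0r_neq0 // sub0r mulrN1 subr_ge0.
set u := 1 + _; have u0 : 0 < u by rewrite /u; nra.
rewrite -[leRHS]lnK // /powR (gt_eqF x0) ler_expR.
have h1 : ln (x / u) <= x / u - 1 by rewrite ln_le_subr1 ?divr_gt0.
have h2 : ln u^-1 <= u^-1 - 1 by rewrite ln_le_subr1 ?invr_gt0.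
rewrite lnM ?posrE ?invr_gt0 // lnV // in h1; rewrite lnV // in h2.
have h3 : g * (x / u) + (1 - g) * u^-1 = 1.
  by rewrite mulrA -mulrDl (_ : g * x + (1 - g) = u) ?divff ?gt_eqF // /u; ring.
nra.
Qed.

Lemma ex_nat_ge (c : R) : exists N0, forall N, (N0 <= N)%N -> c <= N%:R.
Proof.
exists (Num.bound `|c|) => N; rewrite -(ler_nat R) => le.
apply: le_trans (ler_norm c) (le_trans _ le).
by rewrite ltW // archi_boundP.
Qed.

Lemma ex_ln_ge (c : R) : exists2 N0, (0 < N0)%N & forall N, (N0 <= N)%N -> c <= ln N%:R.
Proof.
have [N0 N0P] := ex_nat_ge (expR c); exists N0.+1 => // N lt.
rewrite -ler_expR lnK ?posrE ?ltr0n ?(leq_trans _ lt) //.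
by rewrite N0P // ltnW.
Qed.

Lemma ex_min_nat (h : nat -> R) N : (0 < N)%N ->
  exists2 z, (0 < z <= N)%N & forall v, (0 < v <= N)%N -> h z <= h v.
Proof.
elim: N => // -[_ _|N /(_ isT) [z zN zmin] _].
  by exists 1%N => // v /andP[v0 v1]; have -> : v = 1%N by lia.
have [le|lt] := leP (h z) (h N.+2).
  exists z => [|v vN]; first by lia.
  by have [->|ne] := eqVneq v N.+2; rewrite ?le // zmin //; lia.
exists N.+2 => [|v vN]; first by lia.
have [->|ne] := eqVneq v N.+2; rewrite ?lexx //.
by rewrite (le_trans (ltW lt)) // zmin //; lia.
Qed.

Definition harmonic_sum N : R := \sum_(1 <= m < N.+1) m%:R^-1.

Lemma ln_le_harmonic_sum N : (0 < N)%N -> ln N%:R <= harmonic_sum N.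
Proof.
case: N => // N _; apply: (@le_trans _ _ (harmonic_sum N)); last first.
  by rewrite /harmonic_sum [leRHS]big_nat_recr //= lerDl invr_ge0.
elim: N => [|N IHN]; first by rewrite ln1 /harmonic_sum big_geq.
rewrite /harmonic_sum big_nat_recr //= -/(harmonic_sum N).
have : ln (N.+2%:R / N.+1%:R) <= N.+2%:R / N.+1%:R - 1 :> R.
  by rewrite ln_le_subr1 // divr_gt0.
rewrite lnM ?posrE ?invr_gt0 // lnV ?posrE //.
have -> : N.+2%:R / N.+1%:R - 1 = N.+1%:R^-1 :> R.
  rewrite -[N.+2%:R]natr1 mulrDl divff ?pnatr_eq0 // mul1r; ring.
by rewrite lerBlDl => h; apply: (le_trans h); rewrite lerD2r.
Qed.

Lemma harmonic_sum_le N : (0 < N)%N -> harmonic_sum N <= 1 + ln N%:R.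
Proof.
case: N => // N _; elim: N => [|N IHN].
  by rewrite ln1 /harmonic_sum big_nat1 invr1 addr0.
rewrite /harmonic_sum big_nat_recr //= -/(harmonic_sum N.+1).
have : ln (N.+1%:R / N.+2%:R) <= N.+1%:R / N.+2%:R - 1 :> R.
  by rewrite ln_le_subr1 // divr_gt0.
rewrite lnM ?posrE ?invr_gt0 // lnV ?posrE //.
have -> : N.+1%:R / N.+2%:R - 1 = - N.+2%:R^-1 :> R.
  rewrite -[N.+1%:R](addrK 1) natr1 mulrBl divff ?pnatr_eq0 // mul1r; ring.
move: IHN; move: (ln N.+1%:R : R) (ln N.+2%:R : R) (harmonic_sum _) (_^-1).
move=> A B D E; lra.
Qed.

Lemma mertensS N v : (v <= N)%N ->
  mertens N - mertens v = \sum_(v.+1 <= p < N.+1 | prime p) ln p%:R / p%:R :> R.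
Proof.
by move=> vN; rewrite /mertens (@big_cat_nat _ _ _ v.+1) //= addrAC subrr add0r.
Qed.

Lemma harmonic_sumS N v : (v <= N)%N ->
  harmonic_sum N - harmonic_sum v = \sum_(v.+1 <= m < N.+1) m%:R^-1.
Proof.
by move=> vN; rewrite /harmonic_sum (@big_cat_nat _ _ _ v.+1) //= addrAC subrr add0r.
Qed.

(* A rising-sun argument: z minimizes mertens - (1 + eps) harmonic_sum on [1, N],
   and Mertens' estimate prevents z from being much smaller than N. *)
Lemma ex_regular eps t : 0 < eps -> 0 < t ->
  exists Z0, forall N, (Z0 <= N)%N -> exists z,
    [/\ (0 < z <= N)%N, (1 - t) * ln N%:R <= ln z%:R &
      forall v, (0 < v <= z)%N ->
        mertens z - mertens v <= (1 + eps) * (harmonic_sum z - harmonic_sum v)].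
Proof.
move=> e0 t0; set d := eps * t / 2; have d0 : 0 < d by rewrite divr_gt0 ?mulr_gt0.
have [D0 D0P] := ex_nat_ge (1 + d^-1); pose D := D0.+1.
have DP : 1 + d^-1 <= D%:R by apply: D0P.
have di : 0 < d^-1 by rewrite invr_gt0.
(* [D] is so large that [mertens_le] loses only a factor [1 + d]. *)
have DR : 1 <= (1 - D%:R^-1) * (1 + d).
  have Dp : 0 < D%:R :> R by lra.
  rewrite -(ler_pM2l Dp) mulr1 mulrA mulrBr mulr1 divff ?gt_eqF //.
  have : d * d^-1 = 1 by rewrite divff ?gt_eqF.
  nra.
set C := (1 + d) * ln D%:R + 4 + eps.
have [Z0 Z00 Z0P] := ex_ln_ge (2 * C / (eps * t)).
exists Z0 => N /[dup] ZN /Z0P lnN; have N0 := leq_trans Z00 ZN.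
have [z zN zmin] := ex_min_nat (fun z => mertens z - (1 + eps) * harmonic_sum z) N0.
exists z; split=> // [|v /andP[v0 vz]]; last first.
  have := zmin v; rewrite v0 (leq_trans vz) => [/(_ isT)|]; [lra|by case/andP: zN].
have [z0 _] := andP zN.
have := zmin N; rewrite N0 leqnn => /(_ isT).
have MN : mertens N <= (1 + d) * (ln N%:R + ln D%:R) :> R.
  have := @mertens_le R N D N0 isT; rewrite natrM lnM ?posrE ?ltr0n //.
  have M0 : 0 <= mertens N :> R.
    by apply: sumr_ge0 => p _; rewrite divr_ge0 ?ln_nat_ge0.
  move=> le; apply: (@le_trans _ _ ((1 - D%:R^-1) * (1 + d) * mertens N)).
    by rewrite ler_peMl.
  by rewrite mulrAC mulrC ler_pM2l //; lra.
have := harmonic_sum_le z0; have := ln_le_harmonic_sum N0; have := @mertens_ge R z z0.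
have : C <= d * ln N%:R.
  by move: lnN; rewrite ler_pdivrMr ?mulr_gt0 // /d; lra.
rewrite /C => h1 h2 h3 h4 h5.
(* Comparing [z] with [N] gives [eps ln z >= (eps - d) ln N - C]; moreover [C <= d ln N] and
   [2 d = eps t]. *)
have : eps * (1 - t) * ln N%:R <= eps * ln z%:R by rewrite /d in h1 MN; nra.
by rewrite -mulrA ler_pM2l.
Qed.

(** Abel summation from the top: as [h] increases, a weighted tail is at least its first weight
    times the plain tail. *)
Lemma abel_ge0 (c h : nat -> R) z :
  (forall m, 0 <= h m) -> {homo h : m n / (m <= n)%N >-> m <= n} ->
  (forall v, (v <= z)%N -> 0 <= \sum_(v.+1 <= m < z.+1) c m) ->
  0 <= \sum_(1 <= m < z.+1) c m * h m.
Proof.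
move=> h0 hmono c0.
suff tail k v : (v + k = z)%N ->
    h v.+1 * \sum_(v.+1 <= m < z.+1) c m <= \sum_(v.+1 <= m < z.+1) c m * h m.
  by apply: le_trans (tail z 0%N _); rewrite ?mulr_ge0 ?c0.
elim: k v => [|k IHk] v; first by rewrite addn0 => ->; rewrite !big_geq // mulr0.
rewrite addnS => vk; have lt : (v.+1 < z.+1)%N by lia.
rewrite big_ltn // [leRHS]big_ltn // mulrDr mulrC lerD2l.
apply: le_trans (IHk v.+1 _); last by lia.
by apply: ler_wpM2r; [apply: c0; lia|exact: hmono].
Qed.

(** By [bernoulli_powR] at [1 - 1 / z], the increment of [z ^ g / g] from [z - 1] to [z] is at least
    [z ^ (g - 1)]. *)
Lemma sum_powR_le g z : 0 < g <= 1 ->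
  \sum_(1 <= m < z.+1) m%:R^-1 * m%:R `^ g <= z%:R `^ g / g.
Proof.
move=> /andP[g0 g1]; elim: z => [|z IHz].
  by rewrite big_geq // divr_ge0 ?powR_ge0 // ltW.
rewrite big_nat_recr //=; apply: le_trans (lerD IHz (lexx _)) _.
have z0 : 0 < z.+1%:R :> R by rewrite ltr0n.
have -> : z%:R = z.+1%:R * (1 - z.+1%:R^-1) :> R.
  by rewrite mulrBr mulr1 divff ?gt_eqF // -natr1 addrK.
have z1 : 0 <= 1 - z.+1%:R^-1 :> R by rewrite subr_ge0 invf_le1 // ler1n.
rewrite (powRM _ (ltW z0) z1) -lerBrDr -(ler_pM2l g0).
have := @bernoulli_powR (1 - z.+1%:R^-1) g z1; rewrite g0 => /(_ g1).
have := powR_ge0 (z.+1%:R : R) g.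
set P := _ `^ g; set Q := (1 - _) `^ g; set w := _^-1 => P0 hQ.
have -> : g * (P * Q / g) = P * Q by field; rewrite gt_eqF.
have -> : g * (P / g - w * P) = P * (1 - g * w) by field; rewrite gt_eqF.
by rewrite ler_wpM2l //; apply: le_trans hQ _; lra.
Qed.

(** The hypothesis on [z] makes the tails of [(1 + eps) / m - a m] nonnegative; Abel summation
    against [m ^ g] replaces the primes by all integers. *)
Lemma sum_prime_powR_le eps g z : 0 < g <= 1 -> 0 < eps -> (0 < z)%N ->
  (forall v, (0 < v <= z)%N ->
    mertens z - mertens v <= (1 + eps) * (harmonic_sum z - harmonic_sum v)) ->
  \sum_(0 <= p < z.+1 | prime p) ln p%:R * p%:R `^ (g - 1) <= (1 + eps) * (z%:R `^ g / g).
Proof.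
move=> gP e0 z0 reg; have /andP[g0 g1] := gP.
pose a m : R := if prime m then ln m%:R / m%:R else 0.
have reg0 v : (v <= z)%N ->
    0 <= \sum_(v.+1 <= m < z.+1) ((1 + eps) * m%:R^-1 - a m).
  move=> vz; rewrite sumrB -mulr_sumr -harmonic_sumS // /a -big_mkcond -mertensS // subr_ge0.
  (* The case [v = 0] reduces to [v = 1], as [1] is not prime. *)
  case: v vz => [|v] vz; last by apply: reg.
  apply: le_trans (_ : mertens z - mertens 1 <= _).
    by rewrite /mertens unlock /= !lerD2l lerN2.
  apply: le_trans (reg 1%N _) _ => //; rewrite ler_pM2l ?addr_gt0 // lerD2l lerN2.
  by rewrite /harmonic_sum big_geq // big_nat1 invr_ge0.
have := @abel_ge0 _ (fun m => m%:R `^ g) z _ _ reg0.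
under eq_bigr do rewrite mulrBl -mulrA.
rewrite sumrB -mulr_sumr subr_ge0 => h.
apply: le_trans (_ : (1 + eps) * \sum_(1 <= m < z.+1) m%:R^-1 * m%:R `^ g <= _); last first.
  by rewrite ler_pM2l ?addr_gt0 // sum_powR_le.
apply: le_trans (h _ _) => [|m|m n mn]; [|exact: powR_ge0|]; last first.
  by rewrite ge0_ler_powR ?ler_nat ?nnegrE ?ler0n // ltW.
rewrite big_mkcond big_ltn //= add0r; apply: ler_sum => p _; rewrite /a.
case: ifP => pp; last by rewrite mul0r.
have p0 : 0 < p%:R :> R by rewrite ltr0n prime_gt0.
rewrite powRD; last by rewrite (gt_eqF p0) implybT.
by rewrite (powR_inv1 (ltW p0)) -mulrA [_^-1 * _]mulrC.
Qed.

(** Once [p ^ b >= (1 + eps) / eps], the weights differ by a factor at most [1 + eps]; this holds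
    for [p >= p0], uniformly in [b >= b1]. Below [p0] each term is at most [1 / b], as
    [p ^ b - 1 >= b ln p]. *)
Lemma prime_weights_le eps b1 : 0 < eps -> 0 < b1 -> exists C, forall b z, b1 <= b ->
  \sum_(0 <= p < z.+1 | prime p) ln p%:R / (p%:R `^ b - 1) <=
  (1 + eps) * \sum_(0 <= p < z.+1 | prime p) ln p%:R * p%:R `^ (- b) + C.
Proof.
move=> e0 b10.
have [p0 p0P] := ex_nat_ge (((1 + eps) / eps) `^ b1^-1).
exists (p0%:R * b1^-1) => b z b1b; have b0 : 0 < b by lra.
have term p : prime p -> ln p%:R / (p%:R `^ b - 1) <=
    (1 + eps) * (ln p%:R * p%:R `^ (- b)) + (if (p < p0)%N then b1^-1 else 0).
  move=> pp; have p1 : 1 < p%:R :> R by rewrite ltr1n prime_gt1.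
  have lnp : 0 < ln p%:R :> R by rewrite ln_gt0.
  have q1 : b * ln p%:R <= p%:R `^ b - 1.
    by rewrite lerBrDl /powR gt_eqF ?expR_ge1Dx //; lra.
  have q0 : 0 < p%:R `^ b - 1 by apply: lt_le_trans q1; rewrite mulr_gt0.
  have [lt|le] := ltnP p p0.
    apply: le_trans (_ : b1^-1 <= _); last first.
      by rewrite lerDr !mulr_ge0 ?powR_ge0 ?ltW //; lra.
    apply: le_trans (_ : b^-1 <= _); last by rewrite lef_pV2 ?posrE.
    by rewrite ler_pdivrMr // mulrC ler_pdivlMr // mulrC.
  have : (1 + eps) / eps <= p%:R `^ b.
    apply: le_trans (_ : p%:R `^ b1 <= _); last by rewrite ler_powR // ltW.
    have y0 : 0 <= (1 + eps) / eps by rewrite divr_ge0; lra.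
    rewrite -[leLHS](powRr1 y0) -{2}(mulVf (lt0r_neq0 b10)) powRrM.
    by rewrite ge0_ler_powR ?nnegrE ?powR_ge0 ?ler0n ?p0P // ltW.
  rewrite ler_pdivrMr // addr0 powRN; set q := _ `^ b in q0 *; move=> hq.
  rewrite mulrCA ler_pM2l // ler_pdivlMr ?(lt_trans q0) //; last by lra.
  by rewrite mulrC ler_pdivrMr //; lra.
apply: le_trans (ler_sum _ term) _; rewrite big_split /= -mulr_sumr lerD2l.
have c0 : 0 < b1^-1 by rewrite invr_gt0.
apply: (@le_trans _ _ (\sum_(0 <= p < z.+1) if (p < p0)%N then b1^-1 else 0)).
  rewrite big_mkcond; apply: ler_sum => p _; case: ifP => // _.
  by case: ifP => // _; exact: ltW.
suff -> n : \sum_(0 <= p < n) (if (p < p0)%N then b1^-1 else 0) = (minn n p0)%:R * b1^-1.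
  by rewrite ler_pM2r // ler_nat geq_minr.
elim: n => [|n IHn]; first by rewrite big_geq // min0n mul0r.
rewrite big_nat_recr //= IHn; case: ltnP => h.
  by rewrite (minn_idPl h) -natr1 mulrDl mul1r.
by rewrite (minn_idPr (leqW h)) addr0.
Qed.
End PrimeSums.

(** * Growth of the number of smooth integers *)

Section MaximumPrinciple.
Context {R : realType}.
Implicit Types (b : R).

(** If [2 ^ r <= y / x < 2 ^ (r + 1)] then [ln y - ln 2 <= ln x + r ln 2]. Here [ln x] is a sum over
    the prime powers dividing [x], and [r] counts the [i >= 1] with [2 ^ i x <= y]; then one sums
    over the smooth [x]. *)
Lemma psi_log_le z y : (0 < y)%N ->
  (ln y%:R - ln 2) * (psi z y)%:R <=
  \sum_(0 <= p < z.+1 | prime p) \sum_(1 <= a < y.+1) ln p%:R * (psi z (y %/ p ^ a))%:R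
  + ln 2 * \sum_(1 <= i < y.+1) (psi z (y %/ 2 ^ i))%:R :> R.
Proof.
move=> y0.
have ln2 : 0 <= ln 2 :> R by rewrite ln_ge0 // ler1n.
have term x : (0 < x < y.+1)%N -> smooth z x -> ln y%:R - ln 2 <=
    \sum_(0 <= p < z.+1 | prime p) \sum_(1 <= a < y.+1) ln p%:R * (p ^ a %| x)%:R
    + ln 2 * \sum_(1 <= i < y.+1) (2 ^ i * x <= y)%:R :> R.
  move=> /andP[x0 xy] /smoothP[_ sx]; have xr : 0 < x%:R :> R by rewrite ltr0n.
  pose r := trunc_log 2 (y %/ x).
  have rP : (2 ^ r * x <= y)%N.
    by rewrite -leq_divRL // trunc_logP // divn_gt0.
  have yr : (y < 2 ^ r.+1 * x)%N by rewrite -ltn_divLR // trunc_log_ltn.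
  have ry : (r < y)%N.
    by apply: leq_trans rP; apply: leq_trans (ltn_expl r (isT : 1 < 2)%N) (leq_pmulr _ _).
  have -> : \sum_(0 <= p < z.+1 | prime p) \sum_(1 <= a < y.+1)
      ln p%:R * (p ^ a %| x)%:R = ln x%:R :> R.
    rewrite (ln_prime_sum x0 sx); apply: eq_bigr => p pp.
    rewrite -mulr_sumr mulrC -natr_sum logn_count_dvd //; congr (_%:R * _).
    rewrite [LHS](@big_cat_nat _ _ _ x) ?(ltnW xy) //= [X in (_ + X)%N]big_nat_cond.
    rewrite [X in (_ + X)%N]big1 ?addn0 // => a /andP[/andP[xa _] _].
    apply/eqP; rewrite eqb0 gtnNdvd //.
    by apply: leq_ltn_trans xa (ltn_expl _ (prime_gt1 pp)).
  have count : (r <= \sum_(1 <= i < y.+1) (2 ^ i * x <= y))%N.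
    rewrite (@big_cat_nat _ _ _ r.+1) ?(ltnS r) ?(ltnW ry) //=.
    apply: leq_trans (leq_addr _ _).
    rewrite -{1}[r]subn0 -subSS -[(_ - _)%N]muln1 -sum_nat_const_nat.
    rewrite big_nat [leqRHS]big_nat; apply: leq_sum => i /andP[_ ir].
    by rewrite (leq_trans _ rP) // leq_mul2r leq_exp2l // -ltnS ir orbT.
  have : ln y%:R <= ln (2 ^+ r.+1 * x%:R) :> R.
    rewrite ler_ln ?posrE ?mulr_gt0 ?exprn_gt0 ?ltr0n //.
    by rewrite -natrX -natrM ler_nat ltnW.
  have -> : ln (2 ^+ r.+1 * x%:R) = ln 2 * r%:R + ln 2 + ln x%:R :> R.
    by rewrite lnM ?posrE ?exprn_gt0 // lnXn // mulrSr mulr_natr.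
  have : ln 2 * r%:R <= ln 2 * \sum_(1 <= i < y.+1) (2 ^ i * x <= y)%:R :> R.
    by rewrite ler_wpM2l // -natr_sum ler_nat.
  lra.
rewrite /psi natr_sum mulr_sumr big_nat_cond.
apply: le_trans (ler_sum _ _) _ => [x /andP[xy sx]|].
  by rewrite mulr1; exact: (term x xy sx).
rewrite -big_nat_cond big_split /= -mulr_sumr; apply: lerD.
  rewrite exchange_big /=; apply: ler_sum => p pp.
  rewrite exchange_big /=; apply: ler_sum => a _; rewrite -mulr_sumr.
  rewrite ler_wpM2l ?ln_nat_ge0 // -natr_sum ler_nat.
  apply: leq_trans (psi_dvd z y _); last by rewrite expn_gt0 prime_gt0.
  by rewrite [leqRHS]big_mkcondr /=; apply: leq_sum => x _; case: ifP.
rewrite ler_wpM2l // exchange_big /=; apply: ler_sum => i _.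
rewrite -!natr_sum ler_nat; apply: leq_trans (psi_pow2 z y i).
by rewrite [leqRHS]big_mkcondr /=; apply: leq_sum => x _; case: ifP.
Qed.

Lemma powR_gt1 (x b : R) : 1 < x -> 0 < b -> 1 < x `^ b.
Proof.
move=> x1 b0; rewrite /powR gt_eqF ?(lt_trans ltr01) //.
by rewrite expR_gt1 mulr_gt0 ?ln_gt0.
Qed.

(** The sum of [ln p / p ^ (a b)] over all [a >= 1] and primes [p <= z], that is, minus the
    logarithmic derivative at [b] of the Euler product over these primes. *)
Definition prime_weight z b : R :=
  \sum_(0 <= p < z.+1 | prime p) ln p%:R / (p%:R `^ b - 1).

(* y1 maximizes psi z y / y `^ b over y <= Y0; psi_log_le propagates the bound
   to all y. *)
Lemma psi_maximum z b Y0 : 0 < b -> (0 < Y0)%N ->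
  prime_weight z b + ln 2 / (2 `^ b - 1) + ln 2 <= ln Y0%:R ->
  exists2 y1, (0 < y1 <= Y0)%N &
    forall y, (psi z y)%:R * y1%:R `^ b <= (psi z y1)%:R * y%:R `^ b.
Proof.
move=> b0 Y00 WY.
have [y1 y1Y y1min] := ex_min_nat (fun y => - ((psi z y)%:R / y%:R `^ b)) Y00.
exists y1 => //; have /andP[y10 _] := y1Y.
have pow0 y : (0 < y)%N -> 0 < y%:R `^ b :> R by move=> y00; rewrite powR_gt0 // ltr0n.
pose M := (psi z y1)%:R / y1%:R `^ b; have M0 : 0 <= M by rewrite divr_ge0 ?powR_ge0.
suff main y : (psi z y)%:R <= M * y%:R `^ b.
  move=> y; rewrite -ler_pdivlMr ?pow0 //; apply: le_trans (main y) _.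
  by rewrite /M mulrAC.
elim/ltn_ind: y => y IHy.
have [y0|y0] := posnP y; first by rewrite y0 /psi big_geq // mulr_ge0 ?powR_ge0.
have [yY|Yy] := leqP y Y0.
  have := y1min y; rewrite y0 yY => /(_ isT); rewrite lerN2 -/M.
  by rewrite ler_pdivrMr ?pow0.
(* The induction hypothesis at the [y %/ q ^ a] gives a geometric series of ratio [q ^ (- b)]. *)
have geo q : (1 < q)%N ->
    \sum_(1 <= a < y.+1) (psi z (y %/ q ^ a))%:R <= M * y%:R `^ b * (q%:R `^ b - 1)^-1.
  move=> q1; have q1r : 1 < q%:R :> R by rewrite ltr1n.
  have qb : 1 < q%:R `^ b.
    exact: powR_gt1.
  pose r := (q%:R `^ b)^-1.
  have rE : (q%:R `^ b - 1)^-1 = r / (1 - r) by rewrite /r; field; lra.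
  rewrite rE; apply: (@le_trans _ _ (M * y%:R `^ b * \sum_(1 <= a < y.+1) r ^+ a)).
    rewrite mulr_sumr big_nat [leRHS]big_nat; apply: ler_sum => a /andP[a0 _].
    have qa0 : (0 < q ^ a)%N by rewrite expn_gt0 ltnW.
    apply: le_trans (IHy _ _) _.
      by rewrite ltn_Pdiv // -(expn0 q) ltn_exp2l.
    rewrite -mulrA ler_wpM2l // /r exprVn ler_pdivlMr ?exprn_gt0 ?(lt_trans ltr01) //.
    rewrite -powR_mulrn ?powR_ge0 // powRAC powR_mulrn // -powRM ?ler0n ?exprn_ge0 //.
    rewrite ge0_ler_powR ?(ltW b0) ?nnegrE ?mulr_ge0 ?exprn_ge0 //.
    by rewrite -natrX -natrM ler_nat leq_divM.
  rewrite ler_wpM2l ?mulr_ge0 ?powR_ge0 //; apply: geometric_le.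
  by rewrite /r invr_ge0 powR_ge0 invf_lt1 // (lt_trans ltr01).
have ln2 : 0 < ln 2 :> R by rewrite ln_gt0 // ltr1n.
have := psi_log_le z y0.
set S1 := \sum_(_ <= _ < _ | _) _; set S2 := \sum_(_ <= _ < _) _.
have le1 : S1 <= M * y%:R `^ b * prime_weight z b.
  rewrite /S1 /prime_weight mulr_sumr; apply: ler_sum => p pp.
  rewrite -mulr_sumr mulrCA ler_wpM2l ?ln_nat_ge0 //.
  exact: geo (prime_gt1 pp).
have le2 : ln 2 * S2 <= M * y%:R `^ b * (ln 2 / (2 `^ b - 1)).
  by rewrite mulrCA ler_pM2l //; exact: geo.
have lnY : ln Y0%:R <= ln y%:R :> R.
  by rewrite ler_ln ?posrE ?ltr0n // ler_nat ltnW.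
have W0 : 0 < prime_weight z b + ln 2 / (2 `^ b - 1).
  have qb : 1 < 2 `^ b :> R.
    by rewrite powR_gt1 // ltr1n.
  rewrite ltr_wpDl ?divr_gt0 ?subr_gt0 // sumr_ge0 // => p pp.
  rewrite divr_ge0 ?ln_nat_ge0 // subr_ge0; apply/ltW/powR_gt1 => //.
  by rewrite ltr1n prime_gt1.
(* Since [y > Y0], the total weight is at most [ln y - ln 2]; this positive factor is then
   cancelled. *)
move=> h; have T0 : prime_weight z b + ln 2 / (2 `^ b - 1) <= ln y%:R - ln 2.
  by rewrite lerBrDr (le_trans WY).
have {W0} T1 := lt_le_trans W0 T0.
rewrite -(ler_pM2l T1); apply: le_trans h _; apply: le_trans (lerD le1 le2) _.
by rewrite -mulrDr mulrC ler_wpM2r ?mulr_ge0 ?powR_ge0.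
Qed.
End MaximumPrinciple.

(** * Smooth integers in windows in geometric progression *)

Section Windows.
Context {R : realType}.

Lemma expRN_inv_le (k : nat) : (0 < k)%N ->
  expR (- k%:R^-1) <= 1 - k.+1%:R^-1 :> R.
Proof.
move=> k0; have kr : 0 < k%:R :> R by rewrite ltr0n.
rewrite expRN -[leRHS]invrK lef_pV2 ?posrE ?expR_gt0 //.
  apply: le_trans (expR_ge1Dx _); rewrite -natr1 le_eqVlt; apply/orP; left.
  by apply/eqP; field; rewrite natr1 !pnatr_eq0 -lt0n k0.
by rewrite invr_gt0 subr_gt0 invf_lt1 ?ltr0n // ltr1n.
Qed.

(** With [g] the integer part of [n / Y], every [s <= Y] is at most [n / g], and [w <= z s] means
    [s >= Y / e]. The bound on [F n] is the product of lower bounds for [g / Y ^ 0] and for the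
    window length [h], namely [(n - Y) / Y] and [Y] times the last factor, whose [- 1] pays for
    truncating [w]. *)
Lemma psi_window_real (n z k : nat) (Y : R) : (0 < k)%N -> 1 <= Y -> Y < n%:R ->
  expR 1 * k.+1%:R <= z%:R :> R -> expR 2 <= z%:R :> R ->
  (F n)%:R <= (n%:R - Y) * (z%:R / (expR 1 * k.+1%:R) - 1) ->
  forall w : R, w = z%:R * (Y / expR 1) ->
  (\sum_(1 <= s < (Num.truncn Y).+1 | smooth z s && (Y / expR 1 <= s%:R)%R) 1
     + psi z (Num.truncn (w * expR (- k%:R^-1))%R) <= psi z (Num.truncn w))%N.
Proof.
move=> k0 Y1 Yn kz z2 Fn w wE; set w' := w * _.
have Y0 : 0 < Y by lra.
have e0 : 0 < expR 1 :> R by exact: expR_gt0.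
have kr : 0 < k.+1%:R :> R by rewrite ltr0n.
have z0 : 0 < z%:R :> R by apply: lt_le_trans z2; exact: expR_gt0.
have w0 : 0 < w by rewrite wE !mulr_gt0 ?invr_gt0.
have w'w : w' <= w * (1 - k.+1%:R^-1) by rewrite ler_pM2l // expRN_inv_le.
have ki : 0 < k.+1%:R^-1 :> R by rewrite invr_gt0.
have w'0 : 0 <= w' by rewrite mulr_ge0 ?expR_ge0 // ltW.
(* [psi_window] requires a positive left endpoint; this comes from [expR 2 <= z]. *)
have w'1 : 1 <= w'.
  have : expR (-1) <= expR (- k%:R^-1) :> R.
    by rewrite ler_expR lerN2 invf_le1 ?ler1n ?ltr0n.
  have -> : w' = Y * (expR (- k%:R^-1) / expR (-1)) * (z%:R / expR 2).
    have -> : expR 2 = expR 1 / expR (-1) :> R by rewrite -expRB; congr expR; lra.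
    by rewrite /w' wE; field; rewrite !gt_eqF ?expR_gt0.
  move=> le; apply: mulr_ege1; last by rewrite ler_pdivlMr ?expR_gt0 ?mul1r.
  by apply: mulr_ege1 => //; rewrite ler_pdivlMr ?expR_gt0 ?mul1r.
pose g := Num.truncn (n%:R / Y); pose h := (Num.truncn w - Num.truncn w')%N.
have nY : 1 <= n%:R / Y by rewrite ler_pdivlMr // mul1r ltW.
have g0 : (0 < g)%N by rewrite truncn_gt0.
have tw' : (0 < Num.truncn w')%N by rewrite truncn_gt0.
have tww : (Num.truncn w' <= Num.truncn w)%N.
  by apply: le_truncn; rewrite (le_trans w'w) // ler_piMr ?(ltW w0) // gerBl ltW.
have gP : (n%:R - Y) / Y <= g%:R.
  have := truncnS_gt (n%:R / Y); rewrite -/g -natr1 mulrBl divff ?gt_eqF //.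
  by rewrite lerBlDr => /ltW.
have hP : Y * (z%:R / (expR 1 * k.+1%:R) - 1) <= h%:R.
  rewrite /h natrB //.
  have h1 := truncnS_gt w; rewrite -natr1 in h1.
  have : (Num.truncn w')%:R <= w' by rewrite truncn_le.
  have : w * k.+1%:R^-1 = Y * (z%:R / (expR 1 * k.+1%:R)).
    by rewrite wE; field; rewrite !gt_eqF.
  move: w'w; rewrite !mulrBr !mulr1 => w'w <- lew; move: (w / _) w'w => B w'w; lra.
have zk : 0 <= z%:R / (expR 1 * k.+1%:R) - 1 :> R.
  by rewrite subr_ge0 ler_pdivlMr ?mulr_gt0 // mul1r.
have Fgh : (F n <= g * h)%N.
  rewrite -(ler_nat R) natrM; apply: le_trans Fn _.
  have -> : (n%:R - Y) * (z%:R / (expR 1 * k.+1%:R) - 1) =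
    (n%:R - Y) / Y * (Y * (z%:R / (expR 1 * k.+1%:R) - 1)).
    by field; rewrite !gt_eqF.
  by rewrite ler_pM ?mulr_ge0 ?invr_ge0 //; lra.
have := psi_window z g0 tw' Fgh; rewrite /h subnKC //; apply: leq_trans.
rewrite leq_add2r; apply: (@sum1_le_inj _ _ _ _ _ _ id) => // s /andP[s0 sY] /andP[ss Ys].
have sY' : s%:R <= Y by rewrite -truncn_ge_nat ?(ltW Y0).
split.
  rewrite s0 ltnS leq_divRL // -(ler_nat R) natrM.
  have := truncn_le (n%:R / Y); rewrite -/g (le_trans ler01 nY) => gle.
  apply: le_trans (_ : Y * (n%:R / Y) <= _); first by rewrite ler_pM.
  by rewrite mulrCA divff ?gt_eqF // mulr1.
rewrite ss /= -(ler_nat R) natrM; have := truncn_le w; rewrite (ltW w0) => tle.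
by apply: le_trans tle _; rewrite wE ler_pM2l.
Qed.

Lemma psi_smooth_growth (n z k y1 : nat) : (0 < k)%N -> (0 < y1)%N ->
  expR 1 * y1%:R < n%:R :> R ->
  expR 1 * k.+1%:R <= z%:R :> R -> expR 2 <= z%:R :> R ->
  (F n)%:R <= (n%:R - expR 1 * y1%:R) * (z%:R / (expR 1 * k.+1%:R) - 1) :> R ->
  (k * psi z y1 <= psi z (z * y1))%N.
Proof.
move=> k0 y10 yn kz z2 Fn.
have kr : 0 < k%:R :> R by rewrite ltr0n.
have yr : 0 < y1%:R :> R by rewrite ltr0n.
pose t i : R := expR (- (i%:R / k%:R)).
have tS i : t i.+1 = t i * expR (- k%:R^-1).
  by rewrite /t -expRD -natr1 mulrDl mul1r opprD.
pose w i := Num.truncn (z%:R * (y1%:R * t i) : R).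
pose c i s : bool := smooth z s && (y1%:R * t i <= s%:R <= y1%:R * t i * expR 1).
have step i : (\sum_(1 <= s < y1.+1 | c i s) 1 + psi z (w i.+1) <= psi z (w i))%N.
  have ti : 0 < t i by exact: expR_gt0.
  (* A range of [s] ending before [1] is empty, and monotonicity of [psi] suffices. *)
  have [lt1|ge1] := ltP (y1%:R * t i * expR 1) 1.
    rewrite big_nat_cond big1 ?add0n.
      apply: psi_mono; apply: le_truncn; rewrite tS.
      rewrite !mulrA ler_piMr ?mulr_ge0 ?ler0n ?(ltW ti) //.
    move=> s /andP[/andP[s0 _] /and3P[_ _ sle]].
    have s1 : 1 <= s%:R :> R by rewrite ler1n.
    by exfalso; lra.
  have ti1 : t i <= 1 by rewrite /t expR_le1 oppr_le0 divr_ge0.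
  have Yle : y1%:R * t i * expR 1 <= expR 1 * y1%:R.
    by rewrite mulrC ler_pM2l ?expR_gt0 // ler_piMr.
  have zk : 0 <= z%:R / (expR 1 * k.+1%:R) - 1 :> R.
    by rewrite subr_ge0 ler_pdivlMr ?mulr_gt0 ?expR_gt0 ?ltr0n // mul1r.
  have := @psi_window_real n z k (y1%:R * t i * expR 1) k0 ge1
    (le_lt_trans Yle yn) kz z2 _ _ erefl.
  rewrite mulfK ?gt_eqF ?expR_gt0 //=.
  have -> : z%:R * (y1%:R * t i) * expR (- k%:R^-1) = z%:R * (y1%:R * t i.+1).
    by rewrite tS; ring.
  move=> main.
  apply: leq_trans (main _); last first.
    by apply: le_trans Fn _; rewrite ler_wpM2r // lerD2l lerN2.
  rewrite leq_add2r; apply: (@sum1_le_inj _ _ _ _ _ _ id) => // s /andP[s0 sy].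
  move=> /and3P[ss h1 h2]; split; last by rewrite ss h1.
  by rewrite s0 ltnS truncn_ge_nat ?h2 // (le_trans ler01).
have total I : (\sum_(0 <= i < I) \sum_(1 <= s < y1.+1 | c i s) 1 + psi z (w I) <=
    psi z (w 0))%N.
  elim: I => [|I IHI]; first by rewrite big_geq.
  rewrite big_nat_recr //= -addnA; apply: leq_trans IHI.
  by rewrite leq_add2l.
have w0E : w 0%N = (z * y1)%N.
  by rewrite /w /t mul0r oppr0 expR0 mulr1 -natrM natrK.
(* Enough windows for all the indices used below, since [k ln (y1 / s) <= k y1]. *)
pose I := (k * y1 + k + 1)%N.
have := leq_trans (leq_addr _ _) (total I); rewrite w0E; apply: leq_trans.
rewrite /psi big_distrr /=.
under [leqRHS]eq_bigr => i _ do rewrite /c big_mkcondr /=.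
rewrite exchange_big /= big_nat_cond [leqRHS]big_nat_cond.
apply: leq_sum => s /andP[/andP[s0 sy] ss]; rewrite muln1.
have sr : 0 < s%:R :> R by rewrite ltr0n.
pose x : R := k%:R * ln (y1%:R / s%:R).
have x0 : 0 <= x by rewrite mulr_ge0 // ln_ge0 // ler_pdivlMr // mul1r ler_nat.
have xI : x <= (k * y1)%:R.
  rewrite natrM ler_pM2l // lnM ?posrE ?invr_gt0 // lnV ?posrE //.
  have := @ln_le_subr1 R _ yr; have := @ln_nat_ge0 R s; lra.
have tx : (Num.truncn x <= k * y1)%N by rewrite truncn_le_nat -natr1; lra.
(* The integer [s] is in range [i] whenever [x <= i <= x + k]; the [k] indices starting at
   [truncn x + 1] are kept. *)
rewrite (@big_cat_nat _ _ _ (Num.truncn x).+1) /=; [|by []|rewrite /I; lia].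
apply: leq_trans (leq_addl _ _).
rewrite (@big_cat_nat _ _ _ ((Num.truncn x).+1 + k)) /=;
  [|by rewrite leq_addr|rewrite /I; lia].
apply: leq_trans (leq_addr _ _).
rewrite -{1}[k](addKn (Num.truncn x).+1) -[(_ - _)%N]muln1 -sum_nat_const_nat.
rewrite big_nat [leqRHS]big_nat; apply: leq_sum => i /andP[lo hi].
rewrite ifT //.
have xi : x <= i%:R by apply: le_trans (ltW (truncnS_gt x)) _; rewrite ler_nat.
have ix : i%:R <= x + k%:R.
  have : (Num.truncn x)%:R <= x by rewrite truncn_le.
  have : i%:R <= (Num.truncn x + k)%:R :> R by rewrite ler_nat.
  rewrite natrD; lra.
have yE : s%:R = y1%:R * expR (- (x / k%:R)) :> R.
  rewrite /x mulrAC divff ?gt_eqF // mul1r expRN lnK ?posrE ?divr_gt0 //.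
  by field; rewrite !gt_eqF.
rewrite yE -mulrA -expRD !ler_pM2l // !ler_expR.
have : i%:R / k%:R <= x / k%:R + 1.
  by rewrite -[X in _ + X](divff (lt0r_neq0 kr)) -mulrDl ler_pM2r ?invr_gt0.
rewrite lerN2 ler_pM2r ?invr_gt0 // xi /=; lra.
Qed.

Lemma F_lower (n z k Y0 : nat) (b : R) : 0 < b -> (0 < Y0)%N ->
  z%:R `^ b < k%:R ->
  prime_weight z b + ln 2 / (2 `^ b - 1) + ln 2 <= ln Y0%:R ->
  expR 1 * Y0%:R < n%:R :> R ->
  expR 1 * k.+1%:R <= z%:R :> R -> expR 2 <= z%:R :> R ->
  (n%:R - expR 1 * Y0%:R) * (z%:R / (expR 1 * k.+1%:R) - 1) <= (F n)%:R :> R.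
Proof.
move=> b0 Y00 zk W Yn kz z2.
have [y1 /andP[y10 y1Y] y1max] := psi_maximum b0 Y00 W.
rewrite leNgt; apply/negP => Flt.
have e0 : 0 < expR 1 :> R by exact: expR_gt0.
have k0 : (0 < k)%N by rewrite -(ltr0n R) (le_lt_trans (powR_ge0 _ _) zk).
have le_y : expR 1 * y1%:R <= expR 1 * Y0%:R :> R by rewrite ler_pM2l // ler_nat.
have zk0 : 0 <= z%:R / (expR 1 * k.+1%:R) - 1 :> R.
  by rewrite subr_ge0 ler_pdivlMr ?mulr_gt0 ?ltr0n // mul1r.
have := @psi_smooth_growth n z k y1 k0 y10 (le_lt_trans le_y Yn) kz z2.
have h : (F n)%:R <= (n%:R - expR 1 * y1%:R) * (z%:R / (expR 1 * k.+1%:R) - 1) :> R.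
  by apply: le_trans (ltW Flt) _; rewrite ler_wpM2r // lerD2l lerN2.
move=> /(_ h); rewrite -(ler_nat R) natrM => kpsi.
have := y1max (z * y1)%N; rewrite natrM powRM ?ler0n // mulrA.
have yb : 0 < y1%:R `^ b :> R by rewrite powR_gt0 // ltr0n.
rewrite ler_pM2r // => h2.
have p0 : 0 < (psi z y1)%:R :> R by rewrite ltr0n psi_gt0.
have := le_trans kpsi h2; rewrite mulrC ler_pM2l // leNgt.
by rewrite zk.
Qed.
End Windows.

(** * Choice of the parameters *)

Section Exponents.
Context {R : realType}.

Lemma ln_truncn_ge (y : R) : 1 <= y -> ln y - ln 2 <= ln (Num.truncn y)%:R.
Proof.
move=> y1; have t0 : (0 < Num.truncn y)%N by rewrite truncn_gt0.
have tr : 1 <= (Num.truncn y)%:R :> R by rewrite ler1n.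
have := truncnS_gt y; rewrite -natr1 => lt.
rewrite lerBlDr -lnM ?posrE ?ltr0n // ler_ln ?posrE; lra.
Qed.

(* With g = 1 - b, the parameters satisfy z `^ g = (1 - 3 eta) l and the prime
   weight is about z `^ g / g; b is small but bounded below. *)
Lemma ex_smoothness (eta : R) : 0 < eta -> eta < 6^-1 ->
  exists C l0 : R, forall l, l0 <= l -> exists (z : nat) (b : R),
    [/\ 0 < b, prime_weight z b + ln 2 / (2 `^ b - 1) <= (1 - 2 * eta) * l + C,
      z%:R `^ b * ((1 - 3 * eta) * l) = z%:R & 2 / eta <= z%:R `^ b].
Proof.
(* The slack [c] is small enough for [(1 + c) ^ 2 (1 - 3 eta) <= (1 - 2 eta) (1 - c)]. *)
move=> eta0 eta6; pose c := eta / 10; have c0 : 0 < c by rewrite /c; lra.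
have c60 : c <= 60^-1 by rewrite /c; lra.
pose b1 := c / 8; have b10 : 0 < b1 by rewrite /b1; lra.
have [C CP] := prime_weights_le c0 b10.
have [Z0 Z0P] := @ex_regular R c (c / 4) c0 ltac:(lra).
have u0 : 0 < 1 - 3 * eta by lra.
have ln2 : 0 < ln 2 :> R by rewrite ln_gt0 // ltr1n.
(* A sum of nonnegative terms, each a lower bound required of [ln l]. *)
pose x0 : R := 1 + Z0%:R + 4 * ln 2 / c - ln (1 - 3 * eta) / c ^+ 2 + ln (2 / eta) / b1.
have lnu : ln (1 - 3 * eta) <= 0 by rewrite ln_le0; lra.
have lneta : 0 <= ln (2 / eta) by rewrite ln_ge0 // ler_pdivlMr //; lra.
have p1 : 0 <= 4 * ln 2 / c by rewrite divr_ge0 ?mulr_ge0 //; lra.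
have p2 : 0 <= - ln (1 - 3 * eta) / c ^+ 2 by rewrite divr_ge0 ?exprn_ge0 //; lra.
have p3 : 0 <= ln (2 / eta) / b1 by rewrite divr_ge0 //; lra.
have p4 : 0 <= Z0%:R :> R by [].
exists (C + b1^-1), (expR x0) => l lx0.
have l0 : 0 < l by apply: lt_le_trans lx0; exact: expR_gt0.
set x := ln l; have xx0 : x0 <= x by rewrite -ler_expR lnK.
have x1 : 1 <= x by move: xx0; rewrite /x0; lra.
have xZ : Z0%:R + 1 <= x by move: xx0; rewrite /x0; lra.
have x2 : ln 2 <= c / 4 * x.
  have : 4 * ln 2 / c <= x by move: xx0; rewrite /x0; lra.
  by rewrite ler_pdivrMr //; lra.
have x3 : - ln (1 - 3 * eta) <= c ^+ 2 * x.
  have : - ln (1 - 3 * eta) / c ^+ 2 <= x by move: xx0; rewrite /x0; lra.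
  by rewrite ler_pdivrMr ?exprn_gt0 //; lra.
have x4 : ln (2 / eta) <= b1 * x.
  have : ln (2 / eta) / b1 <= x by move: xx0; rewrite /x0; lra.
  by rewrite ler_pdivrMr //; lra.
(* With [N] about [l ^ (1 + c)], the regular [z] lies between [l ^ (1 + c / 4)] and [l ^ (1 + c)],
   which keeps [g] between [1 - c] and [1 - b1]. *)
pose y := expR ((1 + c) * x); have cx : x <= (1 + c) * x by nra.
have yx : x + 1 <= y by apply: le_trans (expR_ge1Dx _); lra.
pose N := Num.truncn y.
have ZN : (Z0 <= N)%N by rewrite truncn_ge_nat; lra.
have N0 : (0 < N)%N by rewrite truncn_gt0; lra.
have [z [/andP[z0 zN] lnz reg]] := Z0P N ZN.
have zr : 0 < z%:R :> R by rewrite ltr0n.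
have lnN : (1 + c) * x - ln 2 <= ln N%:R.
  have := @ln_truncn_ge y; rewrite expRK; apply; lra.
have lnz_ge : (1 + c / 4) * x <= ln z%:R by nra.
have lnz_le : ln z%:R <= (1 + c) * x.
  rewrite -[leRHS]expRK ler_ln ?posrE ?expR_gt0 //.
  apply: le_trans (_ : N%:R <= _); first by rewrite ler_nat.
  by rewrite truncn_le; lra.
have lz0 : 0 < ln z%:R :> R by nra.
pose L := (1 - 3 * eta) * l; have L0 : 0 < L by rewrite mulr_gt0.
have lnL : ln L = ln (1 - 3 * eta) + x by rewrite lnM ?posrE.
pose g := ln L / ln z%:R.
have gz : g * ln z%:R = ln L by rewrite /g divfK ?gt_eqF.
have g_ge : 1 - c <= g by rewrite ler_pdivlMr //; nra.
have g_le : g <= 1 - b1 by rewrite ler_pdivrMr // /b1; nra.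
pose b := 1 - g; have bb1 : b1 <= b by rewrite /b; lra.
have b0 : 0 < b by lra.
have zg : z%:R `^ g = L by rewrite /powR gt_eqF // gz lnK.
have zb : z%:R `^ b * L = z%:R.
  by rewrite -zg -powRD /b ?subrK ?powRr1 ?(ltW zr) // (gt_eqF zr) implybT.
exists z, b; split=> //; last first.
  rewrite -[leLHS]lnK ?posrE ?divr_gt0 //.
  rewrite /powR gt_eqF // ler_expR; nra.
have gP : 0 < g <= 1 by apply/andP; split; lra.
have := CP b z bb1; have := sum_prime_powR_le gP c0 z0 reg.
rewrite zg (_ : g - 1 = - b); last by rewrite /b; ring.
rewrite -/(prime_weight z b) => h1 h2.
have h3 : ln 2 / (2 `^ b - 1) <= b1^-1 :> R.
  have q1 : b * ln 2 <= 2 `^ b - 1 :> R.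
    by rewrite lerBrDl /powR pnatr_eq0 /= expR_ge1Dx.
  have q0 : 0 < 2 `^ b - 1 :> R by apply: lt_le_trans q1; rewrite mulr_gt0.
  apply: le_trans (_ : b^-1 <= _); last by rewrite lef_pV2 ?posrE.
  by rewrite ler_pdivrMr // mulrC ler_pdivlMr // mulrC.
suff h4 : (1 + c) * ((1 + c) * (L / g)) <= (1 - 2 * eta) * l.
  have : (1 + c) * \sum_(0 <= p < z.+1 | prime p) ln p%:R * p%:R `^ (- b) <=
    (1 + c) * ((1 + c) * (L / g)) by rewrite ler_pM2l //; lra.
  lra.
have g0 : 0 < g by lra.
have -> : (1 + c) * ((1 + c) * (L / g)) = (1 + c) ^+ 2 * (1 - 3 * eta) / g * l.
  by rewrite /L; field; rewrite gt_eqF.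
rewrite ler_pM2r // ler_pdivrMr //.
apply: le_trans (_ : (1 - 2 * eta) * (1 - c) <= _); last by rewrite ler_pM2l; lra.
have -> : eta = 10 * c by rewrite /c; lra.
nra.
Qed.

Theorem F_large (kappa : R) : 0 < kappa -> kappa < (expR 1)^-1 ->
  exists n0, forall n, (n0 <= n)%N -> kappa * (n%:R * ln n%:R) <= (F n)%:R.
Proof.
move=> k0 ke; have e0 : 0 < expR 1 :> R by exact: expR_gt0.
pose q := kappa * expR 1; have q1 : q < 1 by rewrite /q -ltr_pdivlMr // div1r.
have q0 : 0 < q by rewrite mulr_gt0.
(* Thus [kappa = (1 - 6 eta) / e], which is at most [(1 - eta) (1 - 5 eta) / e]. *)
pose eta := (1 - q) / 6; have eta0 : 0 < eta by rewrite /eta; lra.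
have eta6 : eta < 6^-1 by rewrite /eta; lra.
have [C [l0 l0P]] := ex_smoothness eta0 eta6.
have ln2 : 0 < ln 2 :> R by rewrite ln_gt0 // ltr1n.
(* In order, these bounds serve [ex_smoothness], the inequality between the weights and [ln Y0],
   [e Y0 <= eta n], and both [e <= eta l] and [e ^ 2 <= z]. *)
pose l1 := Num.max l0 (Num.max ((C + 2 * ln 2) / eta)
  (Num.max ((1 - ln eta) / eta) (expR 2 / eta))).
have [n0 n00 n0P] := ex_ln_ge l1.
exists n0 => n nn0; set l := ln n%:R; have := n0P n nn0.
have n_gt0 : (0 < n)%N by exact: leq_trans nn0.
have nr : 0 < n%:R :> R by rewrite ltr0n.
rewrite -/l /l1 !ge_max => /and4P[h0 h1 h2 h3].
rewrite ler_pdivrMr // in h1; rewrite ler_pdivrMr // in h2; rewrite ler_pdivrMr // in h3.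
have [z [b [b0 W zb bz]]] := l0P l h0.
pose y := expR ((1 - eta) * l); pose Y0 := Num.truncn y.
have lpos : 0 < l by have := expR_gt0 (2 : R); nra.
have y1 : 1 <= y by rewrite -expR0 ler_expR; nra.
have Y00 : (0 < Y0)%N by rewrite truncn_gt0.
have lnY : (1 - eta) * l - ln 2 <= ln Y0%:R by have := ln_truncn_ge y1; rewrite expRK.
have eY : expR 1 * Y0%:R <= eta * n%:R.
  apply: le_trans (_ : expR 1 * y <= _); first by rewrite ler_pM2l // truncn_le; lra.
  rewrite -[n%:R]lnK // -/l -[eta in leRHS]lnK // -!expRD ler_expR; lra.
pose k := (Num.truncn (z%:R `^ b)).+1.
have zk : z%:R `^ b < k%:R by exact: truncnS_gt.
have bz0 : 0 < z%:R `^ b by apply: lt_le_trans bz; rewrite divr_gt0.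
(* [k + 1] is at most [z ^ b + 2], and [2 <= eta z ^ b]. *)
have kz : k.+1%:R <= (1 + eta) * z%:R `^ b.
  have : (Num.truncn (z%:R `^ b))%:R <= z%:R `^ b by rewrite truncn_le ltW.
  move: bz; rewrite ler_pdivrMr // /k -!natr1; lra.
have kr : 0 < k.+1%:R :> R by rewrite ltr0n.
(* The [+ 1] makes up for the [- 1] in [F_lower]. *)
have main : (1 - 5 * eta) * l / expR 1 + 1 <= z%:R / (expR 1 * k.+1%:R).
  have e2 : expR 1 <= eta * l.
    by apply: le_trans (_ : expR 2 <= _); [rewrite ler_expR ler1n|lra].
  rewrite ler_pdivlMr ?mulr_gt0 //.
  have -> : ((1 - 5 * eta) * l / expR 1 + 1) * (expR 1 * k.+1%:R) =
    ((1 - 5 * eta) * l + expR 1) * k.+1%:R by field; rewrite gt_eqF.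
  apply: le_trans (_ : ((1 - 4 * eta) * l) * ((1 + eta) * z%:R `^ b) <= _).
    by apply: ler_pM => //; [have := expR_gt0 (1 : R)|]; nra.
  rewrite -[leRHS]zb; move: (z%:R `^ b) bz0 => B B0.
  have -> : (1 - 4 * eta) * l * ((1 + eta) * B) = (1 - 4 * eta) * (1 + eta) * (B * l) by ring.
  have -> : B * ((1 - 3 * eta) * l) = (1 - 3 * eta) * (B * l) by ring.
  by rewrite ler_pM2r ?mulr_gt0 //; nra.
have zge : expR 1 * k.+1%:R <= z%:R :> R.
  rewrite -[leLHS]mul1r -ler_pdivlMr ?mulr_gt0 //; apply: le_trans main.
  by rewrite lerDr divr_ge0 // ?(ltW e0) //; nra.
have z2 : expR 2 <= z%:R :> R.
  have zK : (1 - 5 * eta) * l <= z%:R / k.+1%:R.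
    rewrite -(ler_pM2r (_ : 0 < (expR 1)^-1)) ?invr_gt0 //.
    by rewrite -[leRHS]mulrA -invfM [k.+1%:R * _]mulrC; apply: le_trans main; rewrite lerDl.
  have zz : z%:R / k.+1%:R <= z%:R :> R.
    by rewrite ler_pdivrMr // ler_peMr // ler1n.
  apply: le_trans zz; apply: le_trans zK; nra.
have en : expR 1 * Y0%:R < n%:R :> R by nra.
have WY : prime_weight z b + ln 2 / (2 `^ b - 1) + ln 2 <= ln Y0%:R by lra.
have := F_lower b0 Y00 zk WY en zge z2; apply: le_trans.
have -> : kappa = (1 - 6 * eta) / expR 1 by rewrite /eta /q; field; rewrite gt_eqF.
apply: le_trans (_ : (n%:R - eta * n%:R) * ((1 - 5 * eta) * l / expR 1) <= _).
  have -> : (n%:R - eta * n%:R) * ((1 - 5 * eta) * l / expR 1) =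
    ((1 - eta) * (1 - 5 * eta)) / expR 1 * (n%:R * l) by field; rewrite gt_eqF.
  rewrite ler_pM2r ?mulr_gt0 // ler_pM2r ?invr_gt0 //; nra.
apply: ler_pM; last by rewrite lerBrDr.
- by rewrite subr_ge0 ler_piMl //; lra.
- by rewrite divr_ge0 ?(ltW e0) // mulr_ge0 ?(ltW lpos) //; lra.
- by rewrite lerD2l lerN2.
Qed.
End Exponents.

(** * The limit inferior *)

Lemma f_diag_small (R : realType) (eps : R) : 0 < eps ->
  exists n0, forall n, (n0 <= n)%N -> (f n n)%:R <= eps * (n%:R * ln n%:R).
Proof.
move=> eps0; have ln2 : 0 < ln 2 :> R by rewrite ln_gt0 // ltr1n.
(* The factor [ln 2] comes from passing from binary to natural logarithms in [f_diag_bound]. *)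
have [K KP] := ex_nat_ge (8 / (eps * ln 2)).
have [n0 n0P] := f_diag_bound K.
exists n0.+1 => n lt; have n1 : (0 < n)%N by exact: leq_trans lt.
have nr : 0 < n%:R :> R by rewrite ltr0n.
have := n0P n (ltnW lt); rewrite -(ler_nat R) natrM [X in _ <= X]natrM natrM.
have tl : (trunc_log 2 n)%:R * ln 2 <= ln n%:R :> R.
  rewrite mulr_natl -lnXn // ler_ln ?posrE ?exprn_gt0 //.
  by rewrite -natrX ler_nat trunc_logP.
have K2 : 8 / (eps * ln 2) <= (2 ^ K)%:R.
  by apply: KP; exact: ltnW (ltn_expl _ _).
rewrite ler_pdivrMr ?mulr_gt0 // in K2.
set f' := (f n n)%:R; set T := (trunc_log _ _)%:R in tl *; set P := (2 ^ K)%:R in K2 *.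
have f0 : 0 <= f' by rewrite ler0n.
have P0 : 0 < P by rewrite ltr0n expn_gt0.
have T0 : 0 <= T by rewrite ler0n.
move=> h; rewrite -(ler_pM2r P0); apply: le_trans h _.
have -> : eps * (n%:R * ln n%:R) * P = n%:R * (eps * P * ln n%:R) by ring.
have -> : 8 * (n%:R * T) = n%:R * (8 * T) by ring.
rewrite ler_pM2l //.
apply: le_trans (_ : eps * P * (T * ln 2) <= _); last by rewrite ler_pM2l ?mulr_gt0.
have -> : eps * P * (T * ln 2) = P * (eps * ln 2) * T by ring.
by rewrite ler_wpM2r.
Qed.

Lemma limn_einf_ge (R : realType) (u : nat -> \bar R) (c : \bar R) n0 :
  (forall n, (n0 <= n)%N -> (c <= u n)%E) -> (c <= limn_einf u)%E.
Proof.
move=> cu; rewrite limn_einf_lim.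
apply: (@le_trans _ _ (einfs u n0)).
  by apply: le_ereal_inf_tmp => _ [k /= nk <-]; exact: cu.
rewrite (cvg_lim _ (ereal_nondecreasing_cvgn (nondecreasing_einfs u))) //.
by apply: ereal_sup_ubound; exists n0.
Qed.

Theorem theorem1p1 (R : realType) :
  (((expR 1)^-1)%:E <=
   limn_einf (fun n : nat =>
     (((F n)%:R - (f n n)%:R) / (n%:R * ln n%:R) : R)%:E))%E.
Proof.
apply/lee_subgt0Pr => eps eps0.
have e1 : 0 < (expR 1)^-1 :> R by rewrite invr_gt0 expR_gt0.
(* Each of the two estimates costs [d <= eps / 2], and [(expR 1)^-1 - d] stays positive, as
   [F_large] requires. *)
pose d := Num.min (eps / 2) ((expR 1)^-1 / 2).
have d0 : 0 < d by rewrite lt_min; lra.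
have d1 : d <= eps / 2 by rewrite ge_min lexx.
have d2 : d <= (expR 1)^-1 / 2 by rewrite ge_min lexx orbT.
have [|n1 n1P] := @F_large R ((expR 1)^-1 - d) _ ltac:(lra); first lra.
have [n2 n2P] := f_diag_small d0.
apply: (@limn_einf_ge _ _ _ (maxn 2 (maxn n1 n2))) => n.
rewrite !geq_max => /and3P[n_ge2 le1 le2].
rewrite -EFinB lee_fin.
have n0 : 0 < n%:R :> R by rewrite ltr0n ltnW.
have ln0 : 0 < ln n%:R :> R by rewrite ln_gt0 // ltr1n.
have Q0 : 0 < n%:R * ln n%:R :> R by rewrite mulr_gt0.
rewrite ler_pdivlMr //.
have := n1P n le1; have := n2P n le2; nra.
Qed.
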